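(* Let $k \in \mathbb{N}$. Every finite graph $G$ has a canonical tree-decomposition $\mathcal{T}$ of adhesion less than $k$ that distinguishes efficiently every two distinct $k$-profiles of $G$, and which has the further property that every separable $k$-block of $G$ is equal to the unique part of $\mathcal{T}$ in which it is contained.
   Context: All graphs are finite, simple and undirected. Separations. A separation of $G$ is an ordered pair $(A,B)$ of subsets of $V(G)$ with $A\cup B=V(G)$ and no edge between $A\setminus B$ and $B\setminus A$; its order is $|A\cap B|$. Write $(A,B)\le(C,D)$ iff $A\subseteq C$ and $D\subseteq B$. $S_{<k}$ is the set of all separations of $G$ of order less than $k$. A separation $(A,B)$ separates $X\subseteq V(G)$ if $X$ meets both $A\setminus B$ and $B\setminus A$. Blocks. A $k$-block of $G$ is a maximal set of at least $k$ vertices that is not separated by any separation in $S_{<k}$ (i.e. an inclusion-maximal set $X$ separated by no element of $S_{<k}$, with $|X|\ge k$). Profiles. A $k$-profile of $G$ is a set $P\subseteq S_{<k}$ such that: (orientation) for every $(A,B)\in S_{<k}$ exactly one of $(A,B),(B,A)$ is in $P$; (consistency) if $(A,B)\in P$, $(C,D)\in S_{<k}$ and $(C,D)\le(A,B)$ then $(C,D)\in P$; and (P) for all $(A,B),(C,D)\in P$ we have $(B\cap D,A\cup C)\notin P$. A separation $(A,B)$ distinguishes two profiles $P,Q$ if $(A,B)$ lies in one of them and $(B,A)$ in the other; it does so efficiently if its order is minimum among all separations distinguishing $P$ and $Q$. Tree-decompositions. A tree-decomposition of $G$ is a pair $(T,(P_t)_{t\in V(T)})$ of a tree $T$ and sets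 $P_t\subseteq V(G)$ (the parts) such that $\bigcup_t P_t=V(G)$, every edge of $G$ has both ends in some $P_t$, and $P_{t_1}\cap P_{t_3}\subseteq P_{t_2}$ whenever $t_2$ lies on the $t_1$–$t_3$ path in $T$. Its adhesion is the maximum size of an adhesion set $P_t\cap P_{t'}$, $tt'\in E(T)$. An oriented edge $t_1t_2$ of $T$ induces the separation $(\bigcup_{t\in V(T_1)}P_t,\bigcup_{t\in V(T_2)}P_t)$, where $T_i$ is the component of $T-t_1t_2$ containing $t_i$; these are the separations induced by the tree-decomposition. It distinguishes two profiles (efficiently) if some separation induced by it distinguishes them (efficiently). It is canonical if for every automorphism $\varphi$ of $G$ there is an automorphism $\psi$ of $T$ with $\varphi[P_t]=P_{\psi(t)}$ for all $t\in V(T)$. A $k$-block $b$ is separable if there is a tree-decomposition of $G$ of adhesion less than $k$ that has $b$ as one of its parts. *)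

(* Defs.v *)
From mathcomp Require Import all_boot all_order all_fingroup.

Set Implicit Arguments.
Unset Strict Implicit.
Unset Printing Implicit Defensive.

Record sgraph := SGraph {
  vertex :> finType;
  adj : rel vertex;
  adj_sym : symmetric adj;
  adj_irrefl : irreflexive adj
}.

Definition automorphism (G : sgraph) (f : {perm G}) : Prop :=
  forall x y : G, adj (f x) (f y) = adj x y.

Section Separations.
Variable G : sgraph.

(* An ordered pair (A, B) of vertex sets; [separation] singles out the
   separations among these pairs. *)
Definition vpair : finType := ({set G} * {set G})%type.

Implicit Types s r : vpair.

Definition separation s : bool :=
  (s.1 :|: s.2 == [set: G]) &&
  [forall x in s.1 :\: s.2, forall y in s.2 :\: s.1, ~~ adj x y].

Definition sep_order s : nat := #|s.1 :&: s.2|.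

Definition flip s : vpair := (s.2, s.1).

Definition le_sep s r : bool := (s.1 \subset r.1) && (r.2 \subset s.2).

Definition seps_lt (k : nat) : {set vpair} :=
  [set s | separation s && (sep_order s < k)].

Definition separates s (X : {set G}) : bool :=
  (X :&: (s.1 :\: s.2) != set0) && (X :&: (s.2 :\: s.1) != set0).

Definition unseparated (k : nat) (X : {set G}) : bool :=
  [forall s in seps_lt k, ~~ separates s X].

Definition block (k : nat) (X : {set G}) : bool :=
  maxset (unseparated k) X && (k <= #|X|).

(* "Exactly one of (A, B), (B, A)" is read as an exclusive or.  The two pairs
   coincide only for (V, V), which lies in [seps_lt k] only if #|V| < k; there
   are then no k-profiles under either reading, since the last clause applied
   to (V, V) twice forbids (V, V) \in P. *)
Record profile (k : nat) (P : {set vpair}) : Prop := Profile {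
  profile_sub : P \subset seps_lt k;
  profile_orientation :
    forall s, s \in seps_lt k -> (s \in P) (+) (flip s \in P);
  profile_consistent :
    forall s r, s \in P -> r \in seps_lt k -> le_sep r s -> r \in P;
  profile_P :
    forall s r, s \in P -> r \in P ->
      ((s.2 :&: r.2, s.1 :|: r.1) : vpair) \notin P
}.

Definition distinguishes s (P Q : {set vpair}) : bool :=
  ((s \in P) && (flip s \in Q)) || ((s \in Q) && (flip s \in P)).

Definition distinguishes_efficiently s (P Q : {set vpair}) : Prop :=
  distinguishes s P Q /\
  forall r, separation r -> distinguishes r P Q -> sep_order s <= sep_order r.

End Separations.

Record tree (T : sgraph) : Prop := Tree {
  tree_nonempty : 0 < #|T|;
  tree_connected : forall x y : T, connect (@adj T) x y;
  tree_acyclic : forall c : seq T, 2 < size c -> ~~ ucycleb (@adj T) c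
}.

Section TreeDecompositions.
Variables (G T : sgraph) (part : T -> {set G}).

Record tree_decomposition : Prop := TreeDecomposition {
  td_tree : tree T;
  td_cover : \bigcup_(t : T) part t = [set: G];
  td_edge : forall x y : G, adj x y ->
    exists t : T, x \in part t /\ y \in part t;
  td_path : forall (t1 t2 : T) (p : seq T),
    path (@adj T) t1 p -> uniq (t1 :: p) -> t2 \in t1 :: p ->
    part t1 :&: part (last t1 p) \subset part t2
}.

(* The maximum over an empty set of tree edges counts as less than every k,
   including k = 0. *)
Definition adhesion_lt (k : nat) : Prop :=
  forall t t' : T, adj t t' -> #|part t :&: part t'| < k.

Definition del_edge (t1 t2 : T) : rel T :=
  [rel x y | adj x y && ([set x; y] != [set t1; t2])].

(* The component of T - t1t2 containing t1. *)
Definition side (t1 t2 : T) : {set T} :=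
  [set t | connect (del_edge t1 t2) t1 t].

Definition induced_sep (t1 t2 : T) : vpair G :=
  (\bigcup_(t in side t1 t2) part t, \bigcup_(t in side t2 t1) part t).

Definition td_distinguishes_efficiently (P Q : {set vpair G}) : Prop :=
  exists t1 t2 : T,
    adj t1 t2 /\ distinguishes_efficiently (induced_sep t1 t2) P Q.

Definition canonical : Prop :=
  forall f : {perm G}, automorphism f ->
    exists g : {perm T},
      automorphism g /\ forall t : T, f @: part t = part (g t).

End TreeDecompositions.

Definition separable (G : sgraph) (k : nat) (b : {set G}) : Prop :=
  exists (T : sgraph) (part : T -> {set G}),
    [/\ tree_decomposition part, adhesion_lt part k &
        exists t : T, part t = b].

(* Main.v *)
Require Import Defs.
From mathcomp Require Import all_boot all_order all_fingroup.

Set Implicit Arguments.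
Unset Strict Implicit.
Unset Printing Implicit Defensive.

(* The k-profiles are distinguished level by level: among the separations of
   order l that efficiently distinguish some pair of profiles and are nested with
   all earlier choices, take for each pair those crossing the fewest others.
   Submodularity applied to opposite corners shows that they exist and are
   nested.

   A k-block b is separable only if every component C of G - b has fewer than k
   neighbours.  If an efficient chosen separation (A, B) with b contained in B has
   its separator meeting C, then submodularity puts A :&: B inside C together with
   N(C).  Hence adding to C and N(C) all such small sides A gives a set X which
   still meets b in N(C) only, and (X, V - (X - b)) is nested with everything
   chosen so far.  Adding these separations isolates b.

   Finally, a nested set of proper separations, closed under inversion, is the
   edge set of a tree whose nodes are its consistent orientations, and the part
   at a node is the intersection of the sides it points to.  Nothing depends on
   choices, so everything is canonical. *)

(** * Separations *)

(** A separation is read as pointing towards its second side; a profile, an orientation or a block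
    then points each separation to the side where it lives. Canonicity forbids picking one
    separation per pair of profiles, so every minimiser of the crossing count is kept, and any two
    of these must be shown nested. Two opposite corners of crossing separations cross strictly fewer
    candidates in total than the separations themselves. The obstacle is that the corners must again
    compete in the minimisations that the originals won, and which corners do so depends on how the
    four profiles involved orient the two separations. Working upwards in the order helps with the
    earlier choices: a separation of order below l cannot distinguish a pair that needs order l, so
    both profiles orient it alike, and this shared orientation keeps the relevant corners
    distinguishing. Separability of a block refers to an arbitrary tree-decomposition. The added
    separations are built from its consequence for the neighbourhoods of components alone, which is
    visibly invariant under automorphisms. *)

Ltac at_point v :=
  repeat match goal with H : is_true (_ \subset _) |- _ =>
    move: (subsetP H v); clear H end;
  rewrite ?inE;
  repeat match goal with |- context [v \in ?A] => case: (v \in A) end;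
  rewrite /= => *;
  repeat match goal with H : is_true true -> _ |- _ => move: (H isT); clear H end;
  intuition.

Ltac set_solve := let v := fresh "v" in apply/subsetP=> v; at_point v.

Section Separations.
Variable G : sgraph.
Implicit Types s r t x y : vpair G.
Implicit Types P Q : {set vpair G}.

(** With [flip], this single operation yields all four corners of [s] and [r]:
    [sup (flip s) (flip r)] is the corner opposite to [sup s r], again oriented towards an
    intersection of two sides. *)
Definition sup s r : vpair G := (s.1 :|: r.1, s.2 :&: r.2).

Definition nested s r : bool :=
  [|| le_sep s r, le_sep s (flip r), le_sep (flip s) r | le_sep (flip s) (flip r)].

Lemma flipK : involutive (@flip G).
Proof. by case. Qed.

Lemma le_sepxx s : le_sep s s.
Proof. by rewrite /le_sep !subxx. Qed.

Lemma le_sep_trans r s t : le_sep s r -> le_sep r t -> le_sep s t.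
Proof.
by move=> /andP[h1 h2] /andP[h3 h4]; rewrite /le_sep (subset_trans h1 h3) (subset_trans h4 h2).
Qed.

Lemma le_sep_anti s r : le_sep s r -> le_sep r s -> s = r.
Proof.
case: s r => [A B] [C D] /andP[/= h1 h2] /andP[/= h3 h4].
have /eqP -> : A == C by rewrite eqEsubset h1.
by have /eqP -> : B == D by rewrite eqEsubset h4.
Qed.

Lemma le_flip s r : le_sep (flip s) (flip r) = le_sep r s.
Proof. by rewrite /le_sep andbC. Qed.

Lemma le_flipl s r : le_sep (flip s) r = le_sep (flip r) s.
Proof. by rewrite -{1}[r]flipK le_flip. Qed.

Lemma le_flipr s r : le_sep s (flip r) = le_sep r (flip s).
Proof. by rewrite -{1}[s]flipK le_flip. Qed.

Lemma separation_flip s : separation (flip s) = separation s.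
Proof.
rewrite /separation /= setUC; congr (_ && _); apply/'forall_in_forall_inP/'forall_in_forall_inP.
  by move=> h a ha c hc; rewrite adj_sym; apply: h.
by move=> h a ha c hc; rewrite adj_sym; apply: h.
Qed.

Lemma order_flip s : sep_order (flip s) = sep_order s.
Proof. by rewrite /sep_order setIC. Qed.

Lemma seps_flip k s : (flip s \in seps_lt G k) = (s \in seps_lt G k).
Proof. by rewrite !inE separation_flip order_flip. Qed.

Lemma separation_adj s u w :
  separation s -> u \in s.1 -> u \notin s.2 -> w \in s.2 -> w \notin s.1 -> ~~ adj u w.
Proof.
move=> /andP[_ /'forall_in_forall_inP h] u1 u2 w2 w1.
by apply: h; rewrite !inE ?u1 ?u2 ?w1 ?w2.
Qed.

Lemma separationU s u : separation s -> (u \in s.1) || (u \in s.2).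
Proof. by case/andP=> /eqP/setP/(_ u); rewrite !inE. Qed.

Lemma le_supl s r : le_sep s (sup s r).
Proof. by rewrite /le_sep subsetUl subsetIl. Qed.

Lemma le_supr s r : le_sep r (sup s r).
Proof. by rewrite /le_sep subsetUr subsetIr. Qed.

Lemma sup_le s r t : le_sep s t -> le_sep r t -> le_sep (sup s r) t.
Proof. by move=> /andP[h1 h2] /andP[h3 h4]; rewrite /le_sep subUset subsetI h1 h2 h3 h4. Qed.

Lemma separation_sup s r : separation s -> separation r -> separation (sup s r).
Proof.
move=> hs hr; apply/andP; split.
  apply/eqP/setP=> u; rewrite !inE /=.
  by move: (separationU u hs) (separationU u hr); do 4!case: (u \in _).
apply/'forall_in_forall_inP=> u; rewrite !inE /= => hu w; rewrite !inE /= => hw.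
move: (separationU u hs) (separationU u hr) (@separation_adj s u w hs) (@separation_adj r u w hr) hu hw.
by do 4!case: (u \in _) => //=; do 4!case: (w \in _) => //=; auto.
Qed.

(** The union of the two corner separators lies in the union of the old ones, and their intersection
    in the old intersection; both are pointwise checks. *)
Lemma submodular s r :
  sep_order (sup s r) + sep_order (sup (flip s) (flip r)) <= sep_order s + sep_order r.
Proof.
rewrite /sep_order -cardsUI -[leqRHS]cardsUI; apply: leq_add; apply: subset_leq_card; rewrite /=; set_solve.
Qed.

Lemma nestedP s r :
  reflect [\/ le_sep s r, le_sep s (flip r), le_sep (flip s) r | le_sep (flip s) (flip r)]
          (nested s r).
Proof. by apply: (iffP or4P). Qed.

Lemma nested_refl s : nested s s.
Proof. by rewrite /nested le_sepxx. Qed.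

Lemma nested_sym s r : nested s r = nested r s.
Proof.
rewrite /nested !le_flip (le_flipr s) (le_flipl s).
by case: (le_sep s r); case: (le_sep r s); rewrite ?orbT //= !orbF.
Qed.

Lemma nested_flipl s r : nested (flip s) r = nested s r.
Proof.
rewrite /nested flipK.
by do 4!case: (le_sep _ _).
Qed.

Lemma nested_flipr s r : nested s (flip r) = nested s r.
Proof. by rewrite nested_sym nested_flipl nested_sym. Qed.

Lemma le_nested s r : le_sep s r -> nested s r.
Proof. by rewrite /nested => ->. Qed.

Lemma nested_supl s r : nested s (sup s r).
Proof. exact/le_nested/le_supl. Qed.

(** If [t] or [flip t] lies below [s] or [r], it lies below the corner. Otherwise [s] and [r] both
    lie below [t] or both below [flip t], and so does the corner; the mixed case would make [s] and
    [r] nested. *)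
Lemma nested_sup s r t :
  ~~ nested s r -> nested t s -> nested t r -> nested t (sup s r).
Proof.
move=> nsr.
have up q u : le_sep q u -> nested q u by exact: le_nested.
case/nestedP=> h.
- by move=> _; apply/up/(le_sep_trans h)/le_supl.
- case/nestedP=> h'.
  + by apply/up/(le_sep_trans h')/le_supr.
  + rewrite nested_sym -nested_flipr; apply: up; apply: sup_le; by rewrite le_flipr.
  + by rewrite -nested_flipl; apply/up/(le_sep_trans h')/le_supr.
  + case/negP: nsr; rewrite -nested_flipr; apply: up.
    by rewrite le_flipr in h; apply: le_sep_trans h _; rewrite le_flip in h' *.
- by move=> _; rewrite -nested_flipl; apply/up/(le_sep_trans h)/le_supl.
- rewrite le_flip in h; case/nestedP=> h'.
  + by apply/up/(le_sep_trans h')/le_supr.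
  + case/negP: nsr; rewrite -nested_flipr; apply: up; exact: le_sep_trans h h'.
  + by rewrite -nested_flipl; apply/up/(le_sep_trans h')/le_supr.
  + rewrite le_flip in h'; rewrite nested_sym; apply: up; exact: sup_le.
Qed.

(** One of [t], [flip t] lies below one of [s], [flip s], and these two lie below different corners
    of the pair. *)
Lemma nested_sup_opposite s r t :
  nested t s -> nested t (sup s r) || nested t (sup (flip s) (flip r)).
Proof.
case/nestedP=> h; apply/orP; [left|right|left|right].
- exact/le_nested/(le_sep_trans h)/le_supl.
- exact/le_nested/(le_sep_trans h)/le_supl.
- rewrite -nested_flipl; exact/le_nested/(le_sep_trans h)/le_supl.
- rewrite -nested_flipl; exact/le_nested/(le_sep_trans h)/le_supl.
Qed.

(** A strictly monotone measure for [le_sep], so that extremal separations are found by optimising a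
    number. *)
Definition sep_size s : nat := #|s.1| + #|~: s.2|.

Lemma sep_size_le s r : le_sep s r -> sep_size r <= sep_size s -> s = r.
Proof.
move=> /andP[h1 h2]; rewrite -setCS in h2 => h.
have c1 := subset_leq_card h1; have c2 := subset_leq_card h2.
have e1 : #|r.1| <= #|s.1| by rewrite -(leq_add2r #|~: r.2|); apply: leq_trans h _; rewrite leq_add2l.
have e2 : #|~: r.2| <= #|~: s.2| by rewrite -(leq_add2l #|r.1|); apply: leq_trans h _; rewrite leq_add2r.
have /eqP f1 : s.1 == r.1 by rewrite eqEcard h1 e1.
have /eqP f2 : ~: s.2 == ~: r.2 by rewrite eqEcard h2 e2.
by move/setC_inj: f2; case: (s) (r) f1 => [? ?] [? ?] /= -> ->.
Qed.

Lemma exists_minimal (A : {set vpair G}) s :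
  s \in A -> exists2 r, r \in A & forall t, t \in A -> le_sep t r -> t = r.
Proof.
move=> sA; case: (arg_minnP sep_size sA) => r rA h; exists r => // t tA tr.
by apply: sep_size_le => //; apply: h.
Qed.

Lemma exists_maximal (A : {set vpair G}) s :
  s \in A -> exists2 r, r \in A & forall t, t \in A -> le_sep r t -> t = r.
Proof.
move=> sA; case: (arg_maxnP sep_size sA) => r rA h; exists r => // t tA tr.
by apply/esym/sep_size_le => //; apply: h.
Qed.

End Separations.

(** * The tree-decomposition of a nested set of separations *)

Lemma path_exit (T : eqType) (e : rel T) (a : pred T) x p :
  path e x p -> a x -> ~~ a (last x p) ->
  exists u w, [/\ e u w, a u, ~~ a w, u \in x :: p & w \in p].
Proof.
elim: p x => [|y p IH] x /=; first by move=> _ ->.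
case/andP=> exy hp ax nl; case ay: (a y); last first.
  by exists x, y; rewrite exy ax ay !inE !eqxx.
have [u [w [h1 h2 h3 h4 h5]]] := IH y hp ay nl.
exists u, w; split=> //; first by rewrite inE h4 orbT.
by rewrite inE h5 orbT.
Qed.

Section TreeSets.
Variable G : sgraph.
Implicit Types s r t : vpair G.

(** Equivalently, [s] and [flip s] are incomparable under [le_sep]. *)
Definition proper_sep s := ~~ (s.1 \subset s.2) && ~~ (s.2 \subset s.1).

Record tree_set (N : {set vpair G}) : Prop := TreeSet {
  ts_sep : forall s, s \in N -> separation s;
  ts_flip : forall s, s \in N -> flip s \in N;
  ts_nested : forall s r, s \in N -> r \in N -> nested s r;
  ts_proper : forall s, s \in N -> proper_sep s
}.

Definition orientation (N O : {set vpair G}) : bool :=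
  [&& O \subset N,
      [forall s in N, (s \in O) (+) (flip s \in O)] &
      [forall s in O, forall r in N, le_sep r s ==> (r \in O)]].

Definition node (N : {set vpair G}) : finType := {O : {set vpair G} | orientation N O}.

(* The orientation of N towards that end of the edge s which lies on the side s.2. *)
Definition edge_end (N : {set vpair G}) s : {set vpair G} :=
  [set r in N | le_sep r s || (le_sep r (flip s) && (r != flip s))].

Definition node_adj (N : {set vpair G}) : rel (node N) :=
  fun O O' => [exists s in N, (val O == edge_end N s) && (val O' == edge_end N (flip s))].

(** An empty intersection is the whole vertex set, so an empty [N] gives a single node whose part is
    everything. *)
Definition node_part (N : {set vpair G}) (O : node N) : {set G} :=
  \bigcap_(s in val O) s.2.

Section Fixed.
Variable N : {set vpair G}.
Hypothesis tsN : tree_set N.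

Lemma flip_mem s : (flip s \in N) = (s \in N).
Proof. by apply/idP/idP=> /(ts_flip tsN); rewrite ?flipK. Qed.

Lemma proper_le_flip s : proper_sep s -> ~~ le_sep s (flip s).
Proof. by case/andP=> h _; rewrite /le_sep negb_and h. Qed.

Lemma flip_neq s : s \in N -> flip s != s.
Proof.
move/(ts_proper tsN)/proper_le_flip; apply: contra => /eqP->; exact: le_sepxx.
Qed.

(** Otherwise [s.1] would contain both sides of [r], hence every vertex. *)
Lemma le_both s r : s \in N -> r \in N -> le_sep r s -> ~~ le_sep (flip r) s.
Proof.
move=> sN rN /andP[h1 h2]; have /andP[_] := ts_proper tsN sN.
apply: contra => /andP[/= h3 h4].
apply/subsetP=> v _; have:= separationU v (ts_sep tsN rN).
by case/orP; apply/subsetP.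
Qed.

Lemma orientationP (O : {set vpair G}) :
  reflect [/\ forall s, s \in O -> s \in N,
     forall s, s \in N -> (flip s \in O) = (s \notin O) &
     forall s r, s \in O -> r \in N -> le_sep r s -> r \in O] (orientation N O).
Proof.
apply: (iffP and3P) => [[h1 /forall_inP h2 /'forall_in_forall_inP h3]|[h1 h2 h3]]; split.
- exact/subsetP.
- by move=> s /h2; case: (s \in O); case: (flip s \in O).
- by move=> s r sO rN; apply/implyP/h3.
- exact/subsetP.
- by apply/forall_inP => s /h2->; case: (s \in O).
- by apply/'forall_in_forall_inP => s sO r rN; apply/implyP/h3.
Qed.

(** Nestedness with [s] orients every [r], and [le_both] excludes orienting it both ways. The
    exception for [flip s] in [edge_end] prevents the second clause from adding the inversion of [s]
    itself. *)
Lemma edge_end_orientation s : s \in N -> orientation N (edge_end N s).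
Proof.
move=> sN; apply/orientationP; split.
- by move=> r; rewrite inE => /andP[].
- move=> r rN; have fN : flip s \in N by rewrite flip_mem.
  apply/idP/idP.
    rewrite !inE rN /= => /andP[_ h]; apply/negP.
    case/orP: h => [h|/andP[h /negP nh]]; case/orP=> [h'|/andP[h' /negP nh']].
    + by case/negP: (le_both sN rN h').
    + by apply: nh'; rewrite le_flipl in h; apply/eqP/le_sep_anti.
    + by rewrite le_flip in h; apply: nh; rewrite (le_sep_anti h h').
    + by case/negP: (le_both fN rN h').
  rewrite !inE flip_mem rN /= negb_or negb_and negbK => /andP[/negP h1 h2].
  case/nestedP: (ts_nested tsN rN sN) => h //; last 1 first.
  + rewrite h /=; apply/orP; right; apply/negP=> /eqP e.
    by apply: h1; rewrite (can_inj (@flipK G) e) le_sepxx.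
  + by move: h2; rewrite h /= => /eqP->; rewrite flipK le_sepxx.
  + by rewrite h.
- move=> r q; rewrite !inE => /andP[rN h] qN qr; rewrite qN /=.
  case/orP: h => [h|/andP[h n]]; first by rewrite (le_sep_trans qr h).
  rewrite (le_sep_trans qr h) /=; apply/orP; right; apply: contra n => /eqP e.
  by rewrite e in qr; apply/eqP/le_sep_anti.
Qed.

Lemma mem_edge_end s : s \in N -> s \in edge_end N s.
Proof. by move=> sN; rewrite inE sN le_sepxx. Qed.

Lemma flip_notin_edge_end s : s \in N -> flip s \notin edge_end N s.
Proof.
move=> sN; have /orientationP[_ h _] := edge_end_orientation sN.
by rewrite h // negbK mem_edge_end.
Qed.

Definition end_node s (sN : s \in N) : node N := Sub (edge_end N s) (edge_end_orientation sN).

Lemma nodeP (O : node N) :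
  [/\ forall s, s \in val O -> s \in N,
     forall s, s \in N -> (flip s \in val O) = (s \notin val O) &
     forall s r, s \in val O -> r \in N -> le_sep r s -> r \in val O].
Proof. exact/orientationP/(valP O). Qed.

Lemma node_adj_sym : symmetric (@node_adj N).
Proof.
have h (O O' : node N) : node_adj O O' -> node_adj O' O.
  case/exists_inP=> s sN /andP[h1 h2]; apply/exists_inP.
  by exists (flip s); rewrite ?flip_mem // flipK h1 h2.
by move=> O O'; apply/idP/idP; apply: h.
Qed.

Lemma node_adj_irrefl : irreflexive (@node_adj N).
Proof.
move=> O; apply/negbTE/negP; case/exists_inP=> [s sN /andP[/eqP e /eqP e']].
have := flip_notin_edge_end sN; rewrite -e e' mem_edge_end ?flip_mem //.
Qed.

Definition node_graph : sgraph := SGraph node_adj_sym node_adj_irrefl.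

Implicit Types O : node_graph.

(** The two ends of an edge differ only in how they orient that edge. *)
Lemma adj_crossing O O' s :
  adj O O' -> s \in val O -> s \notin val O' ->
  val O = edge_end N s /\ val O' = edge_end N (flip s).
Proof.
case/exists_inP=> r rN /andP[/eqP e /eqP e']; rewrite e e' => h h'.
suff: s = r by move->.
move: h h'; rewrite !inE flipK => /andP[->]; rewrite andTb negb_or negb_and negbK.
case/orP=> [-> /andP[_ /eqP]//|/andP[-> _]]; by rewrite andFb.
Qed.

Lemma path_crossing O (p : seq node_graph) s (sN : s \in N) (fN : flip s \in N) :
  path (@adj node_graph) O p -> s \in val O -> s \notin val (last O p) ->
  (end_node sN \in O :: p) /\ (end_node fN \in p).
Proof.
move=> hp h h'; have [u [w [a us ws hu hw]]] := path_exit (a := fun O => s \in val O) hp h h'.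
have [e e'] := adj_crossing a us ws.
have -> : end_node sN = u by apply: val_inj.
by have -> : end_node fN = w by apply: val_inj.
Qed.

(** Induction on the number of separations in [O] but not in [O']. A maximal such [s] makes [O] the
    end of the edge [s]; moving to the other end inverts [s] and nothing else. *)
Lemma node_connected O O' : connect (@adj node_graph) O O'.
Proof.
move: {2}(#|val O :\: val O'|).+1 (ltnSn #|val O :\: val O'|) => m.
elim: m O => // m IH O; rewrite ltnS => hm.
have [O1 O2 O3] := nodeP O; have [P1 P2 P3] := nodeP O'.
have [e|[s0]] := set_0Vmem (val O :\: val O').
  have -> : O = O'; last exact: connect0.
  apply/val_inj/setP=> s; apply/idP/idP=> h.
    by apply: contraT => n; rewrite -(in_set0 s) -e in_setD n.
  apply: contraT => n; have sN := P1 _ h.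
  have : flip s \in val O :\: val O' by rewrite in_setD O2 // n P2 // h.
  by rewrite e inE.
case/exists_maximal => s; rewrite in_setD => /andP[sO' sO] max.
have sN := O1 _ sO; have fN : flip s \in N by rewrite flip_mem.
have fO' : flip s \in val O' by rewrite P2.
have eO : O = end_node sN.
  apply/val_inj/setP=> r; rewrite /= inE.
  apply/idP/andP=> [rO|[rN]].
    have rN := O1 _ rO; split=> //.
    case/nestedP: (ts_nested tsN rN sN) => h; rewrite ?h //=.
    - by apply/orP; right; apply/eqP=> e; move: rO; rewrite e O2 // sO.
    - rewrite le_flipl in h; have := O3 _ _ rO fN.
      by rewrite -le_flipl le_flipl h => /(_ isT); rewrite O2 // sO.
    - rewrite le_flip in h; case rO': (r \in val O'); last first.
        by rewrite (max r) ?le_sepxx // in_setD rO' rO.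
      by rewrite (P3 _ _ rO' sN h) in sO'.
  case/orP=> [h|/andP[h n]]; first exact: O3 sO _ h.
  apply: contraT => rO; have frO : flip r \in val O by rewrite O2.
  rewrite le_flipr in h; have e : flip r = s; last by rewrite -e flipK eqxx in n.
  apply: (max) (h); rewrite in_setD frO andbT; apply/negP=> frO'.
  by rewrite (P3 _ _ frO' sN h) in sO'.
have a : adj O (end_node fN : node_graph).
  by apply/exists_inP; exists s; rewrite // eO !eqxx.
apply: connect_trans (connect1 a) (IH _ _).
apply: leq_trans hm; apply: proper_card; apply/properP; split.
  apply/subsetP=> r; rewrite !in_setD => /andP[rO'] /=.
  rewrite rO' /= inE eO /= inE flipK => /andP[-> /=].
  case/orP=> [h|/andP[->]] //.
  case/orP: (orbN (r == flip s)) => [/eqP e|->]; last by rewrite h orbT.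
  by rewrite e fO' in rO'.
exists s; first by rewrite in_setD sO' sO.
rewrite in_setD negb_and; apply/orP; right.
by have := flip_notin_edge_end fN; rewrite flipK.
Qed.

Lemma adj_end_nodes s (sN : s \in N) (fN : flip s \in N) :
  adj (end_node sN : node_graph) (end_node fN).
Proof. by apply/exists_inP; exists s; rewrite // !eqxx. Qed.

(** A maximal consistent partial orientation that keeps [X] on the sides it points to is total: a
    minimal undecided separation pointing towards [X] could be added, because everything strictly
    below it already belongs to the orientation. *)
Lemma extend_orientation (X : {set G}) (O0 : {set vpair G}) :
  (forall s, s \in N -> (X \subset s.1) || (X \subset s.2)) ->
  (forall s, s \in O0 -> [/\ s \in N, flip s \notin O0 & X \subset s.2]) ->
  (forall s r, s \in O0 -> r \in N -> le_sep r s -> r \in O0) ->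
  exists O, O0 \subset val O /\ X \subset node_part O.
Proof.
move=> hX h1 h2.
pose good (O : {set vpair G}) := [forall s in O, [&& s \in N, flip s \notin O & X \subset s.2]] &&
   [forall s in O, forall r in N, le_sep r s ==> (r \in O)].
have g0 : good O0.
  apply/andP; split; first by apply/forall_inP=> s /h1[-> ->].
  by apply/'forall_in_forall_inP=> s sO r rN; apply/implyP/h2.
have [O /maxsetP[/andP[/forall_inP g1 /'forall_in_forall_inP g2] maxO] sub] := maxset_exists g0.
have g1' s : s \in O -> [/\ s \in N, flip s \notin O & X \subset s.2].
  by move/g1/and3P.
have tot s : s \in N -> (s \in O) || (flip s \in O).
  move=> sN; apply: contraT; rewrite negb_or => /andP[n1 n2].
  pose U := [set r in N | [&& r \notin O, flip r \notin O & X \subset r.2]].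
  have [s' s'U] : exists s', s' \in U.
    case/orP: (hX _ sN) => hs; last by exists s; rewrite inE sN n1 n2.
    by exists (flip s); rewrite inE flip_mem sN flipK n1 n2.
  have [r rU min] := exists_minimal s'U.
  move: (rU); rewrite inE => /and4P[rN r1 r2 r3].
  have gr : good (r |: O).
    apply/andP; split.
      apply/forall_inP=> t; rewrite in_setU1 => /orP[/eqP->|tO].
        by rewrite rN r3 in_setU1 negb_or r2 (flip_neq rN).
      have [-> t2 ->] := g1' _ tO; rewrite in_setU1 negb_or t2 !andbT /=.
      by apply: contraNN r2 => /eqP <-; rewrite flipK.
    apply/'forall_in_forall_inP=> t; rewrite in_setU1 => /orP[/eqP->|tO] q qN; apply/implyP=> le.
      rewrite in_setU1; case: (boolP (q \in O)) => qO; first by rewrite orbT.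
      rewrite orbF; apply/eqP/min => //; rewrite inE qN qO /=; apply/andP; split.
        apply: contra r2 => fqO; apply: (implyP (g2 _ fqO _ _)); first by rewrite flip_mem.
        by rewrite le_flip.
      by case/andP: le => _; apply: subset_trans.
    by rewrite in_setU1 (implyP (g2 _ tO _ qN)) ?orbT.
  have e := maxO _ gr (subsetUr _ _).
  by move: r1; rewrite -e setU11.
have oO : orientation N O.
  apply/orientationP; split=> [s /g1'[]//|s sN|s r sO rN].
    have := tot _ sN; case: (boolP (s \in O)) => [/g1'[_ /negPf->]|] //=.
  exact/implyP/g2.
exists (Sub O oO); split=> //.
by apply/bigcapsP=> s /= /g1'[].
Qed.

Lemma part_sub O s : s \in val O -> node_part O \subset s.2.
Proof. by move=> h; apply: bigcap_inf. Qed.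

Lemma ex_node (X : {set G}) :
  (forall s, s \in N -> (X \subset s.1) || (X \subset s.2)) ->
  exists O, X \subset node_part O.
Proof.
move=> h; have [||O []] := @extend_orientation X set0 h; try by move=> s; rewrite inE.
by exists O.
Qed.

Lemma ex_node_containing s v : s \in N -> v \in s.2 ->
  exists O, s \in val O /\ v \in node_part O.
Proof.
move=> sN vs.
have [|||O []] := @extend_orientation [set v] [set r in N | le_sep r s].
- move=> r rN; rewrite !sub1set; exact/separationU/(ts_sep tsN).
- move=> r; rewrite !inE => /andP[rN h]; split=> //.
    by rewrite flip_mem rN; apply: le_both.
  by rewrite sub1set; case/andP: h => _ /subsetP; apply.
- by move=> r q; rewrite !inE => /andP[rN h] -> h'; rewrite (le_sep_trans h' h).
move=> /subsetP h; rewrite sub1set; exists O; split=> //.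
by apply: h; rewrite inE sN le_sepxx.
Qed.

Lemma node_tree : tree node_graph.
Proof.
split.
- have [|O _] := @ex_node set0; first by move=> s _; rewrite sub0set.
  by apply/card_gt0P; exists O.
- exact: node_connected.
(* On a cycle, let the edge from [O] to [O'] be that of [s]. The rest of the cycle must cross [s]
   back, and can do so only by visiting [O'] a second time. *)
case=> [|O [|O' [|O'' c]]] //= _; apply/negP => /andP[/= /and3P[a1 a2 a3]].
rewrite !inE !negb_or => /and4P[/and3P[n1 n2 n3] /andP[n4 n5] _ _].
case/exists_inP: (a1) => s sN /andP[/eqP e /eqP e'].
have fN : flip s \in N by rewrite flip_mem.
have nO'' : s \notin val O''.
  apply/negP=> sO''; have a2' : adj (O'' : node_graph) O' by rewrite adj_sym.
  have nO' : s \notin val O' by rewrite e' -{1}[s]flipK flip_notin_edge_end.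
  have [e'' _] := adj_crossing a2' sO'' nO'.
  by case/negP: n2; apply/eqP/val_inj; rewrite /= e e''.
have [|u [w [auw us /negPn ws hu hw]]] := path_exit (a := fun O => s \notin val O) a3 nO''.
  by rewrite last_rcons negbK e mem_edge_end.
have awu : adj (w : node_graph) u by rewrite adj_sym.
have [_ eu] := adj_crossing awu ws us.
have {}eu : u = O' by apply/val_inj; rewrite e'.
by move: hu; rewrite eu inE mem_rcons inE (negPf n4) (negPf n5) orbF /= eq_sym (negPf n1).
Qed.

Lemma node_separation_side O O' : O != O' -> exists2 s, s \in val O & s \notin val O'.
Proof.
move=> n; have [O1 O2 O3] := nodeP O; have [P1 P2 P3] := nodeP O'.
apply/subsetPn; apply: contraNN n => /subsetP h; apply/eqP/val_inj/setP => s.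
apply/idP/idP; first exact: h.
move=> sO'; apply: contraT => n; have sN := P1 _ sO'.
by have := h (flip s); rewrite O2 // P2 // sO' n => /(_ isT).
Qed.

Lemma node_td : tree_decomposition (@node_part N : node_graph -> {set G}).
Proof.
split.
- exact: node_tree.
- apply/setP=> v; rewrite inE; have [|O] := @ex_node [set v].
    by move=> s sN; rewrite !sub1set; exact/separationU/(ts_sep tsN).
  by rewrite sub1set => h; apply/bigcupP; exists O.
- move=> x y xy; have [|O] := @ex_node [set x; y]; last first.
    by rewrite subUset !sub1set => /andP[h1 h2]; exists O.
  move=> s sN; rewrite !subUset !sub1set; have hs := ts_sep tsN sN.
  move: (separationU x hs) (separationU y hs) (@separation_adj _ s x y hs) (@separation_adj _ s y x hs).
  by rewrite [adj y x]adj_sym xy; do 4!case: (_ \in _) => //=; auto.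
move=> t1 t2 p hp up ht2; apply/bigcapsP => s st2.
have [O1 O2 O3] := nodeP t2; have sN := O1 _ st2.
case st1: (s \in val t1); first by apply: subset_trans (subsetIl _ _) (part_sub st1).
case st3: (s \in val (last t1 p)); first by apply: subset_trans (subsetIr _ _) (part_sub st3).
(* If [t2] contains [s] but neither end of the path does, the path crosses the edge [s] before and
   after [t2] and visits its far end twice. *)
exfalso; case/splitPl: ht2 hp up st3 => p1 p2 e.
rewrite last_cat cat_path !e => /andP[hp1 hp2] up st3.
have fN : flip s \in N by rewrite flip_mem.
have ffN : flip (flip s) \in N by rewrite flipK.
have [_ A2 _] := nodeP t1.
have [] := @path_crossing t1 p1 _ fN ffN hp1; first by rewrite A2 // st1.
  by rewrite e O2 // st2.
move=> h _.
have [|_ h'] := @path_crossing t2 p2 _ sN fN hp2 st2; first by rewrite st3.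
move: up; rewrite -cat_cons cat_uniq => /and3P[_ /hasP[]]; exists (end_node fN) => //.
Qed.

Lemma node_adhesion k : (forall s, s \in N -> sep_order s < k) ->
  adhesion_lt (@node_part N : node_graph -> {set G}) k.
Proof.
move=> hk O O' /exists_inP[s sN /andP[/eqP e /eqP e']].
apply: leq_ltn_trans (hk _ sN); apply: subset_leq_card.
have h1 := @part_sub O s; have h2 := @part_sub O' (flip s).
rewrite subsetI (subset_trans (subsetIr _ _) (h2 _)) ?(subset_trans (subsetIl _ _) (h1 _)) //.
  by rewrite e mem_edge_end.
by rewrite e' mem_edge_end ?flip_mem.
Qed.

(** A walk avoiding the edge [s] never changes the orientation of [s]. Conversely, a simple path
    from the end of [s] to a node containing [s] avoids the edge, since it would have to return
    through its starting node. *)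
Lemma side_end_node s (sN : s \in N) (fN : flip s \in N) O :
  (O \in side (end_node sN : node_graph) (end_node fN)) = (s \in val O).
Proof.
have fnE := flip_notin_edge_end fN; rewrite flipK in fnE.
rewrite inE; apply/idP/idP.
  case/connectP=> p; elim: p {1 3 4}(end_node sN) (mem_edge_end sN : s \in val (end_node sN)) => [|O1 p IH] O0 h /=.
    by move=> _ ->.
  case/andP=> /andP[a n] hp; apply: IH hp; apply: contraT => h'.
  have [e e'] := adj_crossing a h h'; case/negP: n; apply/eqP.
  have -> : O0 = end_node sN by apply: val_inj.
  by have -> : O1 = end_node fN by apply: val_inj.
move=> sO; case/connectP: (node_connected (end_node sN) O) => p0 hp0 e0.
case/shortenP: hp0 e0 => p hp up _ eO.
have out : end_node fN \notin p.
  apply/negP=> h; case/splitPr: h hp up eO => p1 p2.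
  rewrite cat_path last_cat /= => /and3P[hp1 a hp2] up eO.
  have ffN : flip (flip s) \in N by rewrite flipK.
  have [] := @path_crossing (end_node fN) p2 _ fN ffN hp2.
  - exact: mem_edge_end.
  - by rewrite -eO; have [_ O2 _] := nodeP O; rewrite O2 ?sO.
  have -> : end_node ffN = end_node sN by apply: val_inj; rewrite /= flipK.
  by move=> _ h; move: up; rewrite /= mem_cat inE h !orbT.
apply/connectP; exists p => //; move: out up hp {eO}.
have: end_node sN != end_node fN.
  by apply: contraNneq fnE => /(congr1 val) /= <-; exact: mem_edge_end.
move: {1 2 3 5}(end_node sN) => O0; elim: p O0 => //= O1 p IH O0 n0.
rewrite inE negb_or => /andP[n1 n2] /andP[u1 u2] /andP[a hp].
apply/andP; split; last by apply: IH => //; rewrite eq_sym.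
rewrite /del_edge /= a /=; apply/eqP=> /setP/(_ (end_node fN)).
by rewrite !inE eqxx orbT (negPf n1) eq_sym (negPf n0).
Qed.

(** The nodes containing [s] have parts inside [s.2], and by [ex_node_containing] these parts
    exhaust it; so the end of [s] contributes [s.2] as first side. *)
Lemma induced_end_node s (sN : s \in N) (fN : flip s \in N) :
  induced_sep (@node_part N : node_graph -> {set G}) (end_node sN) (end_node fN) = flip s.
Proof.
have half r (rN : r \in N) (frN : flip r \in N) :
    \bigcup_(t in side (end_node rN : node_graph) (end_node frN)) node_part t = r.2.
  apply/setP=> v; apply/bigcupP/idP.
    case=> O; rewrite side_end_node => rO; exact/subsetP/part_sub.
  by case/(ex_node_containing rN)=> O [rO vO]; exists O; rewrite ?side_end_node.
rewrite /induced_sep half.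
have ffN : flip (flip s) \in N by rewrite flipK.
have -> : end_node sN = end_node ffN by apply: val_inj; rewrite /= flipK.
by rewrite half.
Qed.

(** At least [k] vertices do not fit into a separator of order below [k]. Hence [b] dictates the
    orientation of every separation at a node whose part contains it, which gives uniqueness and
    expels all vertices outside [b]. *)
Lemma node_of_set k (b : {set G}) :
  (forall s, s \in N -> sep_order s < k) -> k <= #|b| ->
  (forall s, s \in N -> (b \subset s.1) || (b \subset s.2)) ->
  (forall v, v \notin b -> exists s, [/\ s \in N, b \subset s.2 & v \notin s.2]) ->
  exists O, node_part O = b /\ forall O', b \subset node_part O' -> O' = O.
Proof.
move=> hk kb hb hv; have [O bO] := ex_node hb.
exists O; split.
  apply/eqP; rewrite eqEsubset bO andbT; apply/subsetP=> v vO; apply: contraT => /hv[s [sN bs]].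
  case/negP; have [O1 O2 O3] := nodeP O.
  apply: (subsetP (part_sub _)) vO; apply: contraT; rewrite -O2 // => /part_sub h.
  have: k < k; last by rewrite ltnn.
  apply: leq_ltn_trans (hk _ sN); apply: leq_trans kb _; apply: subset_leq_card.
  by rewrite subsetI bs (subset_trans bO h).
move=> O' bO'; apply/eqP; apply: contraT => /node_separation_side[s sO' sO].
have [O1 O2 O3] := nodeP O; have [P1 P2 P3] := nodeP O'; have sN := P1 _ sO'.
have fO : flip s \in val O by rewrite O2.
have: k < k; last by rewrite ltnn.
apply: leq_ltn_trans (hk _ sN); apply: leq_trans kb _; apply: subset_leq_card.
by rewrite subsetI (subset_trans bO (part_sub fO)) (subset_trans bO' (part_sub sO')).
Qed.

End Fixed.
End TreeSets.

(** * Distinguishing profiles *)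

Section Profiles.
Variables (G : sgraph) (k : nat).
Implicit Types s r t x y n c : vpair G.
Implicit Types P Q N : {set vpair G}.

Definition is_profile P : bool :=
  [&& P \subset seps_lt G k,
      [forall s in seps_lt G k, (s \in P) (+) (flip s \in P)],
      [forall s in P, forall r in seps_lt G k, le_sep r s ==> (r \in P)] &
      [forall s in P, forall r in P, ((s.2 :&: r.2, s.1 :|: r.1) : vpair G) \notin P]].

Lemma is_profileP P : reflect (profile k P) (is_profile P).
Proof.
apply: (iffP and4P) => [[h1 /forall_inP h2 /'forall_in_forall_inP h3 /'forall_in_forall_inP h4]|[h1 h2 h3 h4]].
  by split=> // [s r sP rk|s r sP rP]; [apply: (implyP (h3 _ sP _ rk))|apply: h4].
split=> //; first exact/forall_inP.
  by apply/'forall_in_forall_inP => s sP r rk; apply/implyP; exact: h3 sP rk.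
by apply/'forall_in_forall_inP => s sP r rP; apply: h4.
Qed.

Section Facts.
Variable P : {set vpair G}.
Hypothesis hP : profile k P.

Lemma profile_seps s : s \in P -> s \in seps_lt G k.
Proof. exact/subsetP/(profile_sub hP). Qed.

Lemma profile_flip s : s \in seps_lt G k -> (flip s \in P) = (s \notin P).
Proof. by move/(profile_orientation hP); case: (s \in P); case: (flip s \in P). Qed.

(** Property (P) in positive form: it excludes the inversion of the corner, and a corner of order
    below [k] has to be oriented. *)
Lemma profile_sup s r : s \in P -> r \in P -> sup s r \in seps_lt G k -> sup s r \in P.
Proof.
move=> sP rP h; apply: contraT; rewrite -profile_flip // => /negP[].
exact/negP/(profile_P hP).
Qed.

Lemma profile_proper s : s \in P -> ~~ (s.2 \subset s.1).
Proof.
move=> sP; apply/negP => h; have sk := profile_seps sP.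
have : flip s \in P; last by rewrite profile_flip // sP.
by apply: (profile_consistent hP) sP _ _; rewrite ?seps_flip // /le_sep /= h.
Qed.

End Facts.

Lemma distinguishesC s P Q : distinguishes s P Q = distinguishes s Q P.
Proof. by rewrite /distinguishes orbC. Qed.

Lemma distinguishes_flip s P Q : distinguishes (flip s) P Q = distinguishes s P Q.
Proof. by rewrite /distinguishes flipK orbC andbC [X in _ || X]andbC. Qed.

Lemma distinguishes_seps s P Q :
  profile k P -> profile k Q -> distinguishes s P Q -> s \in seps_lt G k.
Proof. by move=> hP hQ /orP[] /andP[/profile_seps h _]; apply: h. Qed.

Lemma distinguishesE s P Q : profile k P -> profile k Q -> s \in seps_lt G k ->
  distinguishes s P Q = ((s \in P) != (s \in Q)).
Proof.
move=> hP hQ sk; rewrite /distinguishes !profile_flip //.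
by case: (s \in P); case: (s \in Q).
Qed.

(** Property (P) puts the corner into [P]; consistency keeps it out of [Q], which would otherwise
    contain both [x] and [y]. *)
Lemma distinguishes_sup x y P Q : profile k P -> profile k Q ->
  x \in P -> y \in P -> (x \notin Q) || (y \notin Q) ->
  sup x y \in seps_lt G k -> distinguishes (sup x y) P Q.
Proof.
move=> hP hQ xP yP h c; rewrite distinguishesE //.
rewrite (profile_sup hP xP yP c); apply/negP=> /eqP/esym cQ.
case/orP: h => /negP[]; apply: (profile_consistent hQ cQ).
- exact: profile_seps hP _ xP.
- exact: le_supl.
- exact: profile_seps hP _ yP.
- exact: le_supr.
Qed.

Definition efficient s P Q : bool :=
  distinguishes s P Q &&
  [forall r, separation r && distinguishes r P Q ==> (sep_order s <= sep_order r)].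

Lemma efficientP s P Q : reflect (distinguishes_efficiently s P Q) (efficient s P Q).
Proof.
apply: (iffP andP) => [[h1 /forallP h2]|[h1 h2]]; split=> //.
  by move=> r hr d; apply: (implyP (h2 r)); rewrite hr.
by apply/forallP=> r; apply/implyP=> /andP[]; apply: h2.
Qed.

Lemma efficientC s P Q : efficient s P Q = efficient s Q P.
Proof.
rewrite /efficient distinguishesC; congr (_ && _).
by apply: eq_forallb => r; rewrite distinguishesC.
Qed.

Lemma efficient_flip s P Q : efficient (flip s) P Q = efficient s P Q.
Proof. by rewrite /efficient distinguishes_flip order_flip. Qed.

Lemma efficient_exists P Q : profile k P -> profile k Q -> P <> Q -> exists s, efficient s P Q.
Proof.
move=> hP hQ n.
have [s ds] : exists s, distinguishes s P Q.
  apply/existsP; apply: contraT; rewrite negb_exists => /forallP h.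
  case: n; apply/setP=> s; apply/idP/idP=> hs; apply: contraT => ns.
    by have := h s; rewrite distinguishesE ?hs ?(negPf ns) //; apply: profile_seps hs.
  by have := h s; rewrite distinguishesE ?hs ?(negPf ns) //; apply: (profile_seps (P := Q)) hs.
have [r dr min] := arg_minnP (P := fun s => distinguishes s P Q) (@sep_order G) ds.
by exists r; apply/efficientP; split=> // t _; apply: min.
Qed.

(** * Canonical choice of nested efficient separations *)

Definition far (l : nat) P Q : Prop :=
  forall r, separation r -> distinguishes r P Q -> l <= sep_order r.

Lemma farC l P Q : far l P Q -> far l Q P.
Proof. by move=> h r hr; rewrite distinguishesC; apply: h. Qed.

Definition candidates (l : nat) N : {set vpair G} :=
  [set s | [&& sep_order s == l, [forall n in N, nested s n] &
     [exists P, exists Q, [&& is_profile P, is_profile Q & efficient s P Q]]]].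

Definition crossings (A : {set vpair G}) s : nat := #|[set r in A | ~~ nested s r]|.

Definition least_crossing (l : nat) N : {set vpair G} :=
  [set s in candidates l N |
    [exists P, exists Q, [&& is_profile P, is_profile Q, efficient s P Q &
      [forall r in candidates l N, efficient r P Q ==>
        (crossings (candidates l N) s <= crossings (candidates l N) r)]]]].

Fixpoint level (l : nat) : {set vpair G} :=
  if l is m.+1 then level m :|: least_crossing m (level m) else set0.

Lemma candidatesP l N s :
  reflect [/\ sep_order s = l, forall n, n \in N -> nested s n &
    exists P Q, [/\ profile k P, profile k Q & efficient s P Q]] (s \in candidates l N).
Proof.
rewrite inE; apply: (iffP and3P) => [[/eqP h1 /forall_inP h2 /existsP[P /existsP[Q /and3P[]]]]|].
  by move=> /is_profileP hP /is_profileP hQ e; split=> //; exists P, Q.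
move=> [-> h2 [P [Q [/is_profileP hP /is_profileP hQ e]]]]; split=> //.
  exact/forall_inP.
by apply/existsP; exists P; apply/existsP; exists Q; rewrite hP hQ e.
Qed.

Lemma candidates_seps l N s : s \in candidates l N -> s \in seps_lt G k.
Proof.
case/candidatesP=> _ _ [P [Q [hP hQ /andP[e _]]]]; exact: distinguishes_seps hP hQ e.
Qed.

Lemma seps_separation s : s \in seps_lt G k -> separation s.
Proof. by rewrite inE => /andP[]. Qed.

Lemma candidates_flip l N s : s \in candidates l N -> flip s \in candidates l N.
Proof.
case/candidatesP=> h1 h2 [P [Q [hP hQ e]]]; apply/candidatesP; rewrite order_flip; split=> //.
  by move=> n /h2; rewrite nested_flipl.
by exists P, Q; rewrite efficient_flip.
Qed.

Lemma crossings_flip A s : crossings A (flip s) = crossings A s.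
Proof. by apply: eq_card => r; rewrite !inE nested_flipl. Qed.

Lemma least_crossingP l N s :
  reflect [/\ s \in candidates l N &
    exists P Q, [/\ profile k P, profile k Q, efficient s P Q & forall r,
     r \in candidates l N -> efficient r P Q ->
     crossings (candidates l N) s <= crossings (candidates l N) r]] (s \in least_crossing l N).
Proof.
rewrite [s \in least_crossing _ _]inE.
apply: (iffP andP) => [[h1 /existsP[P /existsP[Q /and4P[]]]]|].
  move=> /is_profileP hP /is_profileP hQ e /forall_inP m; split=> //; exists P, Q; split=> //.
  by move=> r rc; apply/implyP/m.
move=> [h1 [P [Q [/is_profileP hP /is_profileP hQ e m]]]]; split=> //.
apply/existsP; exists P; apply/existsP; exists Q; rewrite hP hQ e /=.
by apply/forall_inP=> r rc; apply/implyP/m.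
Qed.

(** By [nested_sup] and [nested_sup_opposite], a separation crossing one corner crosses [x] or [y],
    and one crossing both corners crosses both. The count drops strictly because [x] crosses [y] but
    neither corner. *)
Lemma crossings_sup (A : {set vpair G}) x y : x \in A -> y \in A -> ~~ nested x y ->
  crossings A (sup x y) + crossings A (sup (flip x) (flip y)) <
  crossings A x + crossings A y.
Proof.
move=> xA yA nxy; rewrite /crossings -cardsUI -[ltnRHS]cardsUI.
rewrite -addSn; apply: leq_add; last first.
  apply/subset_leq_card/subsetP=> t; rewrite !inE => /andP[/andP[-> h1] /andP[_ h2]] /=.
  move: h1 h2; rewrite !(nested_sym _ t) => h1 h2; apply/andP; split.
    by apply: contra h1 => h; have := nested_sup_opposite y h; rewrite (negPf h2) orbF.
  apply: contra h1 => h; have := nested_sup_opposite x h.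
  by rewrite /sup (setUC y.1) (setIC y.2) (setUC y.2) (setIC y.1) => /orP[|h'] //; case/negP: h2.
apply: proper_card; apply/properP; split.
  apply/subsetP=> t; rewrite !inE => h; have tA : t \in A by case/orP: h => /andP[].
  move: h; rewrite tA /= -!negb_and; apply: contraNN.
  rewrite !(nested_sym _ t) => /andP[h1 h2].
  rewrite !nested_sup ?nested_flipr //; by rewrite nested_flipl.
exists x; rewrite !inE xA ?nested_refl /= ?(nested_sym y) ?nxy ?orbT //.
rewrite !(nested_sym _ x) nested_supl /=.
by rewrite -nested_flipl nested_supl.
Qed.

(* Both corners have order at least l, hence exactly l by submodularity. *)
Lemma opposite_corners l N x y P Q P' Q' :
  profile k P -> profile k Q -> profile k P' -> profile k Q' ->
  far l P Q -> far l P' Q' ->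
  x \in candidates l N -> y \in candidates l N -> ~~ nested x y ->
  (sup x y \in seps_lt G k -> distinguishes (sup x y) P Q) ->
  (sup (flip x) (flip y) \in seps_lt G k ->
     distinguishes (sup (flip x) (flip y)) P' Q') ->
  [/\ sup x y \in candidates l N, efficient (sup x y) P Q,
      sup (flip x) (flip y) \in candidates l N &
      efficient (sup (flip x) (flip y)) P' Q'].
Proof.
move=> hP hQ hP' hQ' far1 far2 xc yc nxy d1 d2.
have xk := candidates_seps xc; have yk := candidates_seps yc.
have lk : l < k by case/candidatesP: xc => <- _ _; move: xk; rewrite inE => /andP[].
have sx := seps_separation xk; have sy := seps_separation yk.
have s1 : separation (sup x y) by exact: separation_sup.
have s2 : separation (sup (flip x) (flip y)) by apply: separation_sup; rewrite separation_flip.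
have ge q A B : far l A B -> separation q -> (q \in seps_lt G k -> distinguishes q A B) -> l <= sep_order q.
  move=> fAB sq dq; rewrite leqNgt; apply/negP=> lt.
  have qk : q \in seps_lt G k by rewrite inE sq (ltn_trans lt lk).
  by move: lt; rewrite ltnNge fAB // dq.
have g1 := ge _ _ _ far1 s1 d1; have g2 := ge _ _ _ far2 s2 d2.
have [ox nx _] := candidatesP _ _ _ xc; have [oy ny _] := candidatesP _ _ _ yc.
have := submodular x y; rewrite ox oy => sm.
have o1 : sep_order (sup x y) = l.
  apply/eqP; rewrite eqn_leq g1 andbT -(leq_add2r l); apply: leq_trans sm.
  by rewrite leq_add2l.
have o2 : sep_order (sup (flip x) (flip y)) = l.
  apply/eqP; rewrite eqn_leq g2 andbT -(leq_add2l l); apply: leq_trans sm.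
  by rewrite leq_add2r.
have e1 : efficient (sup x y) P Q.
  apply/efficientP; split; first by apply: d1; rewrite inE s1 o1.
  by rewrite o1.
have e2 : efficient (sup (flip x) (flip y)) P' Q'.
  apply/efficientP; split; first by apply: d2; rewrite inE s2 o2.
  by rewrite o2.
split=> //; apply/candidatesP; split=> //; try by exists P, Q.
- by move=> n nN; rewrite nested_sym nested_sup // nested_sym ?nx ?ny.
- move=> n nN; rewrite nested_sym nested_sup ?nested_flipl ?nested_flipr //.
    by rewrite nested_sym nx.
  by rewrite nested_sym ny.
- by exists P', Q'.
Qed.

(** The contradiction common to all cases of [least_crossing_nested]: both corners are candidates,
    so [a] and [b] bound their crossing counts from below, against [crossings_sup]. Both bounds may
    come from the same pair of profiles. *)
Lemma uncross l N x y P Q P' Q' (a b : nat) :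
  profile k P -> profile k Q -> profile k P' -> profile k Q' ->
  far l P Q -> far l P' Q' ->
  x \in candidates l N -> y \in candidates l N -> ~~ nested x y ->
  (forall c, c \in candidates l N -> efficient c P Q -> a <= crossings (candidates l N) c) ->
  (forall c, c \in candidates l N -> efficient c P' Q' -> b <= crossings (candidates l N) c) ->
  crossings (candidates l N) x + crossings (candidates l N) y <= a + b ->
  x \in P -> y \in P -> (x \notin Q) || (y \notin Q) ->
  x \notin P' -> y \notin P' -> (x \in Q') || (y \in Q') -> False.
Proof.
move=> hP hQ hP' hQ' far1 far2 xc yc nxy ma mb le xP yP xyQ xP' yP' xyQ'.
have xk := candidates_seps xc; have yk := candidates_seps yc.
have [||c1 e1 c2 e2] := opposite_corners hP hQ hP' hQ' far1 far2 xc yc nxy.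
- exact: distinguishes_sup.
- by apply: distinguishes_sup => //; rewrite !profile_flip ?negbK.
have := crossings_sup xc yc nxy; rewrite ltnNge => /negP[].
by apply: leq_trans le _; apply: leq_add; [apply: ma|apply: mb].
Qed.

Lemma efficient_far s P Q : efficient s P Q -> far (sep_order s) P Q.
Proof. by case/efficientP. Qed.

Lemma orient_efficient s P Q : profile k P -> profile k Q -> efficient s P Q ->
  exists P' Q', [/\ profile k P', profile k Q', s \in P', s \notin Q' &
    forall r, efficient r P' Q' = efficient r P Q].
Proof.
move=> hP hQ e; have d : distinguishes s P Q by case/andP: e.
have sk := distinguishes_seps hP hQ d.
case/orP: d => /andP[h1]; rewrite profile_flip // => h2; first by exists P, Q.
by exists Q, P; split=> // r; rewrite efficientC.
Qed.

Lemma least_crossing_nested l N r s :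
  r \in least_crossing l N -> s \in least_crossing l N -> nested r s.
Proof.
move=> /least_crossingP[rc [P0 [Q0 [hP0 hQ0 er0 mr0]]]].
move=> /least_crossingP[sc [P1 [Q1 [hP1 hQ1 es1 ms1]]]].
have [P [Q [hP hQ rP rQ eqP]]] := orient_efficient hP0 hQ0 er0.
have [P' [Q' [hP' hQ' sP' sQ' eqP']]] := orient_efficient hP1 hQ1 es1.
have er : efficient r P Q by rewrite eqP.
have es : efficient s P' Q' by rewrite eqP'.
have mr c : c \in candidates l N -> efficient c P Q ->
    crossings (candidates l N) r <= crossings (candidates l N) c.
  by move=> cc; rewrite eqP; apply: mr0.
have ms c : c \in candidates l N -> efficient c P' Q' ->
    crossings (candidates l N) s <= crossings (candidates l N) c.
  by move=> cc; rewrite eqP'; apply: ms1.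
clear P0 Q0 hP0 hQ0 er0 mr0 eqP P1 Q1 hP1 hQ1 es1 ms1 eqP'.
apply: contraT => nrs; exfalso.
have rk := candidates_seps rc; have sk := candidates_seps sc.
have [oreq _ _] := candidatesP _ _ _ rc; have [os _ _] := candidatesP _ _ _ sc.
have farP : far l P Q by rewrite -oreq; apply: efficient_far.
have farP' : far l P' Q' by rewrite -os; apply: efficient_far.
have frc := candidates_flip rc; have fsc := candidates_flip sc.
have cfr := crossings_flip (candidates l N) r; have cfs := crossings_flip (candidates l N) s.
have mrC c : c \in candidates l N -> efficient c Q P ->
    crossings (candidates l N) r <= crossings (candidates l N) c.
  by move=> cc; rewrite efficientC; apply: mr.
have msC c : c \in candidates l N -> efficient c Q' P' ->
    crossings (candidates l N) s <= crossings (candidates l N) c.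
  by move=> cc; rewrite efficientC; apply: ms.
have farQ := farC farP; have farQ' := farC farP'.
(* If [r] also distinguishes [P'] and [Q'], it competes with [s] there. This serves the two cases in
   which both corners are compared on [P] and [Q]. *)
have both : distinguishes r P' Q' -> crossings (candidates l N) s <= crossings (candidates l N) r.
  move=> d; apply: ms rc _; apply/efficientP; split=> //.
  by move=> t st; rewrite oreq; apply: farP'.
have fl R : profile k R -> (flip r \in R) = (r \notin R) by move=> h; apply: profile_flip.
have fl' R : profile k R -> (flip s \in R) = (s \notin R) by move=> h; apply: profile_flip.
have dr : distinguishes r P' Q' = ((r \in P') != (r \in Q')) by apply: distinguishesE.
have n1 : ~~ nested r (flip s) by rewrite nested_flipr.
have n2 : ~~ nested (flip r) s by rewrite nested_flipl.
have n3 : ~~ nested (flip r) (flip s) by rewrite nested_flipl.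
(* The cases record how [P], [Q] orient [s] and how [P'], [Q'] orient [r]. Each time, suitable
   inversions of [r] and [s] give opposite corners that distinguish one of the two pairs each, or
   both distinguish [P] and [Q]. *)
case p: (s \in P); case q': (r \in Q').
- case q: (s \in Q); last first.
    case p': (r \in P').
      by apply: (uncross hQ hP hP' hQ' farQ farP' frc fsc n3 mrC ms); rewrite ?fl ?fl' ?p ?q ?p' ?q' ?rP ?sP' ?rQ ?sQ' ?cfr ?cfs.
    by apply: (uncross hP hQ hQ hP farP farQ rc sc nrs mr mrC); rewrite ?p ?q ?rP ?rQ ?leq_add2l ?both ?dr ?p' ?q'.
  by apply: (uncross hQ hP hQ' hP' farQ farQ' frc sc n2 mrC msC); rewrite ?fl ?p ?q ?q' ?rP ?sP' ?rQ ?sQ' ?cfr ?orbT.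
- by apply: (uncross hP hQ hQ' hP' farP farQ' rc sc nrs mr msC); rewrite ?p ?q' ?rP ?sP' ?rQ ?sQ' ?orbT.
- case p': (r \in P'); last first.
    by apply: (uncross hP hQ hP' hQ' farP farP' rc fsc n1 mr ms); rewrite ?fl' ?p ?p' ?q' ?rP ?sP' ?rQ ?sQ' ?cfs ?orbT.
  case q: (s \in Q).
    by apply: (uncross hQ hP hQ' hP' farQ farQ' frc sc n2 mrC msC); rewrite ?fl ?p ?q ?q' ?rP ?sP' ?rQ ?sQ' ?cfr ?orbT.
  by apply: (uncross hQ hP hP' hQ' farQ farP' frc fsc n3 mrC ms); rewrite ?fl ?fl' ?p ?q ?p' ?q' ?rP ?sP' ?rQ ?sQ' ?cfr ?cfs.
case p': (r \in P'); last first.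
  by apply: (uncross hP hQ hP' hQ' farP farP' rc fsc n1 mr ms); rewrite ?fl' ?p ?p' ?q' ?rP ?sP' ?rQ ?sQ' ?cfs ?orbT.
case q: (s \in Q).
  by apply: (uncross hP hQ hQ hP farP farQ rc fsc n1 mr mrC); rewrite ?fl' ?p ?q ?rP ?rQ ?cfs ?leq_add2l ?both ?dr ?p' ?q'.
by apply: (uncross hQ hP hP' hQ' farQ farP' frc fsc n3 mrC ms); rewrite ?fl ?fl' ?p ?q ?p' ?q' ?rP ?sP' ?rQ ?sQ' ?cfr ?cfs ?orbT.
Qed.

(* If r crosses the fewest elements of N, then it crosses none: otherwise, by
   submodularity, a corner either crosses fewer elements of N or distinguishes
   the two profiles separated by the crossed element at a lower order. *)
Lemma efficient_nested l N P Q r0 :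
  (forall n, n \in N -> sep_order n < l /\
     exists P' Q', [/\ profile k P', profile k Q' & efficient n P' Q']) ->
  (forall n m, n \in N -> m \in N -> nested n m) ->
  (forall n, n \in N -> flip n \in N) ->
  profile k P -> profile k Q -> efficient r0 P Q -> sep_order r0 = l ->
  exists r, efficient r P Q /\ forall n, n \in N -> nested r n.
Proof.
move=> hN nestN flipN hP0 hQ0 e0 o0.
have [r er min] := arg_minnP (P := fun r => efficient r P Q) (crossings N) e0.
exists r; split=> //; have o : sep_order r = l.
  move/efficientP: er => [d1 h1]; move/efficientP: e0 => [d2 h2].
  apply/eqP; rewrite -o0 eqn_leq h1 ?h2 //; apply: (seps_separation (distinguishes_seps hP0 hQ0 _)); done.
move=> n0 n0N; apply: contraT => nr0; exfalso.
have {hP0 hQ0 er e0 min} [P1 [Q1 [hP hQ rP rQ [er min]]]] :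
    exists P Q, [/\ profile k P, profile k Q, r \in P, r \notin Q &
      efficient r P Q /\ forall c, efficient c P Q -> crossings N r <= crossings N c].
  have [P' [Q' [? ? ? ? e]]] := orient_efficient hP0 hQ0 er.
  exists P', Q'; split=> //; split; first by rewrite e.
  by move=> c; rewrite e; apply: min.
have rk := profile_seps hP rP; have far1 := efficient_far er; rewrite o in far1.
have lk : l < k by move: rk; rewrite inE o => /andP[].
have [on0 [P'0 [Q'0 [hP'0 hQ'0 e'0]]]] := hN _ n0N.
have d0 : distinguishes n0 P'0 Q'0 by case/andP: e'0.
have n0k := distinguishes_seps hP'0 hQ'0 d0.
(* The order of [n0] is too small to distinguish the pair, so both profiles contain the same
   orientation of it, which becomes [m]. *)
have agree : (n0 \in P1) = (n0 \in Q1).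
  apply/eqP; apply: contraT => d; have := far1 n0 (seps_separation n0k).
  by rewrite distinguishesE // d leqNgt on0 => /(_ isT).
have [m [mN om mP mQ nmr]] : exists m, [/\ m \in N, sep_order m < l, m \in P1, m \in Q1 & ~~ nested m r].
  case p: (n0 \in P1); first by exists n0; rewrite -agree p nested_sym.
  by exists (flip n0); rewrite (profile_flip hP n0k) (profile_flip hQ n0k) -agree p nested_flipl nested_sym order_flip flipN.
have [_ [A [B [hA hB eAB]]]] := hN _ mN.
have [Q2 [P2 [hQ2 hP2 mQ2 mP2 em]]] := orient_efficient hA hB eAB.
have {eAB hA hB}farm : far (sep_order m) P2 Q2 by apply/farC/efficient_far; rewrite em.
have mk := profile_seps hQ2 mQ2.
have sm := seps_separation mk; have sr := seps_separation rk.
(* A corner of order at most [l] would be efficient for the pair, nested with [m], and nested with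
   every element of [N] that is nested with [r], contradicting the minimality of [r]. *)
have big C D x : profile k C -> profile k D -> (forall c, efficient c C D = efficient c P1 Q1) ->
   x \in C -> x \notin D -> m \in C -> ~~ nested m x -> (forall t, nested t x = nested t r) ->
   l < sep_order (sup m x).
  move=> hC hD eCD xC xD mC nmx nx; rewrite ltnNge; apply/negP=> le.
  have xk := profile_seps hC xC; have sx := seps_separation xk.
  have ck : sup m x \in seps_lt G k.
    by rewrite inE separation_sup //= (leq_ltn_trans le lk).
  have dc : distinguishes (sup m x) C D by apply: distinguishes_sup; rewrite // xD orbT.
  have far2 : far l C D by have := efficient_far (P := C) (Q := D) (s := r); rewrite eCD o; apply.
  have : efficient (sup m x) C D.
    by apply/efficientP; split=> // t st dt; apply: leq_trans le _; apply: far2.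
  rewrite eCD => /min; rewrite leqNgt => /negP[]; apply: proper_card; apply/properP; split.
    apply/subsetP=> t; rewrite !inE => /andP[tN]; rewrite tN /=; apply: contra => h.
    by rewrite nested_sym; apply: nested_sup => //; [exact: nestN|by rewrite nx nested_sym].
  exists m; rewrite !inE mN /= nested_sym ?nmr //.
  by rewrite negbK nested_supl.
have big1 := big P1 Q1 r hP hQ (fun c => erefl) rP rQ mP nmr (fun t => erefl).
have big2 : l < sep_order (sup m (flip r)).
  apply: (big Q1 P1) => //; rewrite ?profile_flip ?negbK ?nested_flipr //.
    by move=> c; apply: efficientC.
  by move=> t; rewrite nested_flipr.
(* Opposite to a corner of order above [l], submodularity leaves an order below that of [m]; yet
   this corner distinguishes the pair for which [m] is efficient. *)
have small x : x \in P2 -> sep_order x = l -> l < sep_order (sup m (flip x)) -> False.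
  move=> xP2 ox lt; have xk := profile_seps hP2 xP2.
  have sx := seps_separation xk.
  have lt2 : sep_order (sup (flip m) x) < sep_order m.
    rewrite -(ltn_add2r l) addnC; apply: leq_trans (_ : _ <= sep_order m + sep_order (flip x)) _.
      apply: leq_trans (submodular m (flip x)).
      by rewrite flipK -addSn leq_add2r.
    by rewrite order_flip ox.
  have ss : separation (sup (flip m) x) by apply: separation_sup; rewrite ?separation_flip.
  move: (lt2); rewrite ltnNge => /negP[]; apply: farm => //; apply: distinguishes_sup => //.
  - by rewrite profile_flip.
  - by rewrite profile_flip // negbK mQ2.
  - by rewrite inE ss (ltn_trans lt2) // (ltn_trans om lk).
case p: (r \in P2); first exact: small p o big2.
by apply: (small (flip r)); rewrite ?profile_flip ?p ?order_flip ?flipK.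
Qed.

Lemma level_spec l :
  [/\ forall n, n \in level l -> sep_order n < l /\
        exists P Q, [/\ profile k P, profile k Q & efficient n P Q],
      forall n m, n \in level l -> m \in level l -> nested n m,
      forall n, n \in level l -> flip n \in level l &
      forall P Q s, profile k P -> profile k Q -> efficient s P Q -> sep_order s < l ->
        exists2 n, n \in level l & efficient n P Q].
Proof.
elim: l => [|l [h1 h2 h3 h4]]; first by split=> [n|n m|n|P Q s _ _ _] //; rewrite inE.
split=> [n|n m|n|P Q s hP hQ e]; rewrite ?in_setU.
- case/orP=> [/h1[h ?]|/least_crossingP[/candidatesP[-> _ ex] _]]; last by [].
  by split=> //; apply: ltnW.
- have mixed t u : t \in level l -> u \in least_crossing l (level l) -> nested u t.
    by move=> tl /least_crossingP[/candidatesP[_ h _] _]; apply: h.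
  case/orP=> hn /orP[] hm; try by [apply: h2 | apply: mixed | rewrite nested_sym mixed].
  exact: least_crossing_nested hn hm.
- case/orP=> [/h3->//|/least_crossingP[/candidates_flip c [P [Q [hP hQ e m]]]]].
  apply/orP; right; apply/least_crossingP; split=> //; exists P, Q.
  by rewrite efficient_flip; split=> // r; rewrite crossings_flip; apply: m.
rewrite ltnS leq_eqVlt => /orP[/eqP o|lt]; last first.
  by have [n nl en] := h4 _ _ _ hP hQ e lt; exists n; rewrite // in_setU nl.
(* This makes the set over which crossings are minimised nonempty. *)
have [r [er nr]] := efficient_nested h1 h2 h3 hP hQ e o.
pose B := [set r in candidates l (level l) | efficient r P Q].
have rB : r \in B.
  rewrite inE er andbT; apply/candidatesP; split=> //; last by exists P, Q.
  have dr : distinguishes r P Q by case/andP: er.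
  have ds : distinguishes s P Q by case/andP: e.
  apply/eqP; rewrite -o eqn_leq (efficient_far er) ?(efficient_far e) //;
  apply/seps_separation; exact: distinguishes_seps hP hQ _.
have [n nB min] := arg_minnP (crossings (candidates l (level l))) rB.
move: (nB : n \in B); rewrite inE => /andP[nc en]; exists n => //; rewrite in_setU; apply/orP; right.
apply/least_crossingP; split=> //; exists P, Q; split=> // t tc et.
by apply: min; have : t \in B by rewrite inE tc et.
Qed.

End Profiles.

(** * Isolating blocks *)

Section Blocks.
Variables (G : sgraph) (k : nat).
Implicit Types s r t n m : vpair G.
Implicit Types b : {set G}.
Implicit Types u v w : G.

Definition avoiding b : rel G := [rel x y | [&& adj x y, x \notin b & y \notin b]].
Definition component b v : {set G} := [set w | connect (avoiding b) v w].
Definition boundary b v : {set G} := [set u in b | [exists w in component b v, adj w u]].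

Lemma component_refl b v : v \in component b v.
Proof. by rewrite inE connect0. Qed.

Lemma component_notin b v w : v \notin b -> w \in component b v -> w \notin b.
Proof.
move=> vb; rewrite inE => /connectP[p]; elim: p v vb => [|u p IH] v vb /=; first by move=> _ ->.
by case/andP=> /and3P[_ _ ub]; apply: IH.
Qed.

Lemma component_adj b v u w : v \notin b -> u \in component b v -> adj u w -> w \notin b ->
  w \in component b v.
Proof.
move=> vb uC uw wb; have ub := component_notin vb uC; move: uC; rewrite !inE => uC.
by apply: connect_trans uC (connect1 _); rewrite /avoiding /= uw ub wb.
Qed.

Lemma component_ind b v (D : {set G}) : v \notin b -> v \in D ->
  (forall u w, u \in component b v -> u \in D -> w \notin b -> adj u w -> w \in D) ->
  component b v \subset D.
Proof.
move=> vb vD h; apply/subsetP=> w; rewrite inE => /connectP[p hp ->].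
elim/last_ind: p hp => [|p u IH] //; rewrite rcons_path last_rcons => /andP[hp /and3P[a _ ub]].
by apply: (h _ _ _ (IH hp)) => //; rewrite inE; apply/connectP; exists p.
Qed.

Lemma avoiding_sym b : connect_sym (avoiding b).
Proof.
apply: symmetric_from_pre => x y.
suff pre z w : avoiding b z w -> avoiding b w z.
  case/connectP => p hp ->; elim: p x hp => [|z p IH] x /=; first by rewrite connect0.
  by move=> /andP[/pre/connect1 a /IH h]; apply: connect_trans h a.
by rewrite /avoiding /= adj_sym => /and3P[-> -> ->].
Qed.

Lemma component_eq b v w : w \in component b v -> component b w = component b v.
Proof.
rewrite inE => h; apply/setP=> u; rewrite !inE; apply/idP/idP; first exact: connect_trans.
by apply: connect_trans; rewrite avoiding_sym.
Qed.

Definition block_profile b : {set vpair G} := [set s in seps_lt G k | b \subset s.2].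

Section Unseparated.
Variable b : {set G}.
Hypothesis unb : unseparated k b.
Hypothesis kb : k <= #|b|.

Lemma big_side s : s \in seps_lt G k -> (b \subset s.1) || (b \subset s.2).
Proof.
move=> sk; have /separationU hU := seps_separation sk.
have := forall_inP unb s sk; rewrite /separates negb_and !negbK.
case/orP=> /eqP/setP e; apply/orP; [right|left]; apply/subsetP=> u ub.
  by have := e u; have := hU u; rewrite !inE ub; case: (u \in s.1); case: (u \in s.2).
by have := e u; have := hU u; rewrite !inE ub; case: (u \in s.1); case: (u \in s.2).
Qed.

Lemma not_both_sides s : s \in seps_lt G k -> b \subset s.2 -> ~~ (b \subset s.1).
Proof.
rewrite inE => /andP[_ o] h2; apply/negP=> h1; have: k < k; last by rewrite ltnn.
by apply: leq_ltn_trans o; apply: leq_trans kb (subset_leq_card _); rewrite subsetI h1.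
Qed.

Lemma block_profileP : profile k (block_profile b).
Proof.
split.
- by apply/subsetP=> s; rewrite inE => /andP[].
- move=> s sk; rewrite ![_ \in block_profile b]in_set seps_flip sk.
  have := big_side sk; have := not_both_sides sk.
  by case: (b \subset s.1); case: (b \subset s.2) => //= /(_ isT).
- move=> s r; rewrite ![_ \in block_profile b]in_set => /andP[_ h] -> /andP[_ h'].
  exact: subset_trans h h'.
move=> s r; rewrite ![_ \in block_profile b]in_set => /andP[_ h] /andP[_ h'].
apply/negP=> /andP[]; rewrite in_set => /andP[_ o] h3.
have: k < k; last by rewrite ltnn.
by apply: leq_ltn_trans o; apply: leq_trans kb (subset_leq_card _); rewrite !subsetI h h'.
Qed.

Definition cut v : vpair G := (component b v :|: boundary b v, ~: component b v).

Lemma cut_separation v : v \notin b -> separation (cut v).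
Proof.
move=> vb; apply/andP; split.
  by apply/eqP/setP=> u; rewrite !in_set /=; case: (connect _ _ _); rewrite ?orbT.
apply/'forall_in_forall_inP => u; rewrite in_setD in_setC negbK => /andP[uC _] w.
rewrite in_setD in_setU negb_or => /andP[/andP[wC wb] _]; apply/negP=> a.
case wB: (w \in b); last first.
  by case/negP: wC; apply: component_adj vb uC a _; rewrite ?wB.
by case/negP: wb; rewrite inE wB; apply/exists_inP; exists u.
Qed.

Lemma cut_order v : v \notin b -> sep_order (cut v) = #|boundary b v|.
Proof.
move=> vb; apply: eq_card => u; rewrite in_setI in_setU in_setC.
case uC: (u \in component b v); rewrite /= ?andbF ?andbT //.
by apply/esym/negP; rewrite inE (negPf (component_notin vb uC)).
Qed.

Lemma component_side n v : separation n -> v \notin b -> b \subset n.2 ->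
  [disjoint component b v & n.1 :&: n.2] ->
  (component b v \subset n.1 :\: n.2) || (component b v \subset n.2 :\: n.1).
Proof.
move=> sn vb bn dis.
have split u : u \in component b v -> (u \in n.1) != (u \in n.2).
  move=> uC; have := separationU u sn; have := disjointFr dis uC; rewrite inE.
  by case: (u \in n.1); case: (u \in n.2).
have sp := split v (component_refl b v).
case v1: (v \in n.1).
  apply/orP; left; apply: component_ind => //; first by move: sp; rewrite !inE v1 andbT.
  move=> u w uC uD wb a; have wC := component_adj vb uC a wb; have := split w wC.
  move: uD; rewrite !inE => /andP[u2 u1].
  have := @separation_adj _ n u w sn u1 u2; rewrite a.
  by case: (w \in n.1); case: (w \in n.2) => // /(_ isT isT).
apply/orP; right; apply: component_ind => //; first by move: sp; rewrite !inE v1; case: (v \in n.2).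
move=> u w uC uD wb a; have wC := component_adj vb uC a wb; have := split w wC.
move: uD; rewrite !inE => /andP[u2 u1].
have := @separation_adj _ n w u sn; rewrite [adj w u]adj_sym a u1 u2.
by case: (w \in n.1); case: (w \in n.2) => // /(_ isT isT isT isT).
Qed.

(* Of the two corners of n with the cut around C, the one on the side of Q
   has order at least that of n by efficiency; by submodularity the other one
   has order at most |N(C)|, which confines the separator of n. *)
Lemma efficient_separator n P Q v :
  profile k P -> profile k Q -> efficient n P Q -> b \subset n.2 ->
  v \notin b -> #|boundary b v| < k ->
  ~~ [disjoint component b v & n.1 :&: n.2] ->
  n.1 :&: n.2 \subset component b v :|: boundary b v.
Proof.
move=> hP0 hQ0 e0 bn vb Nk ndis.
have [P1 [Q1 [hP1 hQ1 nP1 nQ1 eE]]] := orient_efficient hP0 hQ0 e0.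
have e1 : efficient n P1 Q1 by rewrite eE.
have nk := profile_seps hP1 nP1; have sn := seps_separation nk.
have far1 := efficient_far e1.
have sx := cut_separation vb; have ox := cut_order vb.
have xk : cut v \in seps_lt G k by rewrite inE sx ox.
(* The corner of [y] and [flip n] lies in [Q1] but not in [P1], so efficiency bounds its order from
   below, and submodularity bounds the opposite one from above. *)
have key y : y = cut v \/ y = flip (cut v) -> y \in Q1 -> sep_order (sup (flip y) n) <= #|boundary b v|.
  move=> hy yQ.
  have yk := profile_seps hQ1 yQ; have sy := seps_separation yk.
  have oy : sep_order y = #|boundary b v| by case: hy => ->; rewrite ?order_flip ox.
  have ge : sep_order n <= sep_order (sup y (flip n)).
    rewrite leqNgt; apply/negP=> lt.
    have ss : separation (sup y (flip n)) by apply: separation_sup; rewrite ?separation_flip.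
    move: (lt); rewrite ltnNge => /negP[]; apply: far1 => //.
    rewrite distinguishesC; apply: (distinguishes_sup hQ1 hP1) => //.
    - by rewrite (profile_flip hQ1 nk).
    - by rewrite (profile_flip hP1 nk) negbK nP1 orbT.
    - rewrite inE ss (ltn_trans lt) //; by move: nk; rewrite inE => /andP[].
  have := submodular y (flip n); rewrite flipK order_flip oy => sm.
  by rewrite -(leq_add2r (sep_order n)); apply: leq_trans sm; rewrite addnC leq_add2r.
(* For this orientation the opposite corner has all of N(C) and also a vertex of C in its separator,
   one more than the bound allows. *)
case xQ: (cut v \in Q1).
  have := key _ (or_introl erefl) xQ; rewrite leqNgt => /negP[].
  case/pred0Pn: ndis => w /andP[/= wC]; rewrite inE => /andP[w1 w2].
  apply: proper_card; apply/properP; split.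
    apply/subsetP=> u uN; have ub : u \in b by move: uN; rewrite inE => /andP[].
    have uC : u \notin component b v by apply/negP=> /(component_notin vb); rewrite ub.
    by rewrite /sup /= !(in_setI, in_setU, in_setC) uC uN (subsetP bn u ub) orbT.
  exists w; first by rewrite /sup /= !(in_setI, in_setU, in_setC) wC w1 w2 orbT.
  by rewrite in_set (negPf (component_notin vb wC)).
(* For the other orientation the bound is attained: the separator of the corner equals N(C), and it
   contains the separator of [n] outside C. *)
have := key _ (or_intror erefl); rewrite flipK (profile_flip hQ1 xk) xQ => /(_ isT) le.
have sub : boundary b v \subset (sup (cut v) n).1 :&: (sup (cut v) n).2.
  apply/subsetP=> u uN; have ub : u \in b by move: uN; rewrite inE => /andP[].
  have uC : u \notin component b v by apply/negP=> /(component_notin vb); rewrite ub.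
  by rewrite /sup /= !(in_setI, in_setU, in_setC) uC uN (subsetP bn u ub) orbT.
have /eqP e : boundary b v == (sup (cut v) n).1 :&: (sup (cut v) n).2 by rewrite eqEcard sub.
apply/subsetP=> u; rewrite in_setI => /andP[u1 u2]; rewrite in_setU.
case uC: (u \in component b v) => //=.
by rewrite e /sup /= !(in_setI, in_setU, in_setC) uC u1 u2 orbT.
Qed.

(** * Hulls of components *)

Section Refinement.
Variable N : {set vpair G}.
Hypothesis effN : forall n, n \in N -> exists P Q, [/\ profile k P, profile k Q & efficient n P Q].
Hypothesis nestedN : forall n m, n \in N -> m \in N -> nested n m.
Hypothesis boundaries : forall v, v \notin b -> #|boundary b v| < k.

Definition meets_separator v n : bool :=
  [&& n \in N, b \subset n.2 & ~~ [disjoint component b v & n.1 :&: n.2]].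

(** The plain [cut v] may cross the elements of [N] whose separator meets the component; absorbing
    their small sides puts them below the new separation. *)
Definition hull v : {set G} :=
  component b v :|: boundary b v :|: \bigcup_(n | meets_separator v n) n.1.

Definition hull_sep v : vpair G := (hull v, ~: hull v :|: b).

(** Selects the components that no single element of [N] already cuts off from [b]; only these
    receive a new separation. *)
Definition uncut v : bool :=
  (v \notin b) && [forall n in N, (b \subset n.2) ==> ~~ (component b v \subset n.1 :\: n.2)].

Lemma effN_seps n : n \in N -> n \in seps_lt G k.
Proof. by case/effN=> P [Q [hP hQ /andP[e _]]]; apply: distinguishes_seps hP hQ e. Qed.

Lemma separator_sub v n : v \notin b -> meets_separator v n ->
  n.1 :&: n.2 \subset component b v :|: boundary b v.
Proof.
move=> vb /and3P[nN bn nd]; have [P [Q [hP hQ e]]] := effN nN.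
exact: efficient_separator hP hQ e bn vb (boundaries vb) nd.
Qed.

Lemma hull_le v n : meets_separator v n -> le_sep n (hull_sep v).
Proof.
move=> hn; have /and3P[_ bn _] := hn; apply/andP; split; rewrite /= /hull.
  by apply: subset_trans (subsetUr _ _); apply: bigcup_sup.
apply/subsetP=> u; rewrite in_setU in_setC => /orP[|ub]; last exact: (subsetP bn).
rewrite in_setU negb_or => /andP[_ h].
have sn : separation n by case/and3P: hn => /effN_seps/seps_separation.
case/orP: (separationU u sn) => // u1; case/negP: h; apply/bigcupP; by exists n.
Qed.

(** A vertex of [b] in an absorbed [n.1] lies in the separator of [n], which is confined to C and
    N(C); so absorption does not enlarge the separator. *)
Lemma hull_boundary v : v \notin b -> (hull_sep v).1 :&: (hull_sep v).2 = boundary b v.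
Proof.
move=> vb; apply/setP=> u; rewrite /= in_setI in_setU in_setC.
apply/andP/idP=> [[uh]|uN]; last first.
  have ub : u \in b by move: uN; rewrite inE => /andP[].
  by rewrite ub orbT !in_setU uN orbT.
rewrite uh /= => ub; move: uh; rewrite !in_setU.
have uC : u \notin component b v by apply/negP=> /(component_notin vb); rewrite ub.
rewrite (negPf uC) /= => /orP[] // /bigcupP[n hn un].
have /and3P[_ bn _] := hn.
have := subsetP (separator_sub vb hn) u.
by rewrite in_setI un (subsetP bn) // in_setU (negPf uC) => /(_ isT).
Qed.

(** An edge leaving an absorbed [n.1] must start in the separator of [n], hence, outside [b], in C
    itself; and edges from C end in C or N(C). *)
Lemma hull_separation v : v \notin b -> separation (hull_sep v).
Proof.
move=> vb; apply/andP; split.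
  by rewrite /= setUA setUCr setTU.
apply/'forall_in_forall_inP => x; rewrite in_setD => /andP[x2 x1] y.
rewrite in_setD => /andP[y1 _]; apply/negP=> a.
rewrite /= in_setU in_setC x1 /= in x2; rewrite /= in y1 x1.
have yC : y \notin component b v /\ y \notin boundary b v.
  by move: y1; rewrite /hull in_setU negb_or in_setU negb_or => /andP[/andP[]].
have C x' : x' \in component b v -> adj x' y -> False.
  move=> xC a'; case yb: (y \in b); last by case: yC => /negP[]; apply: component_adj vb xC a' _; rewrite yb.
  by case: yC => _ /negP[]; rewrite inE yb; apply/exists_inP; exists x'.
move: x1; rewrite /hull in_setU => /orP[|/bigcupP[n hn xn]].
  rewrite in_setU => /orP[h|]; first exact: C h a.
  by rewrite inE (negPf x2).
have sn : separation n by case/and3P: hn => /effN_seps/seps_separation.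
have yn : y \notin n.1.
  by apply: contra y1 => h; rewrite /hull in_setU; apply/orP; right; apply/bigcupP; exists n.
have yn2 : y \in n.2 by have := separationU y sn; rewrite (negPf yn).
case x2n: (x \in n.2).
  have := subsetP (separator_sub vb hn) x; rewrite in_setI xn x2n in_setU => /(_ isT)/orP[h|].
    exact: C h a.
  by rewrite inE (negPf x2).
by have := separation_adj sn xn _ yn2 yn; rewrite x2n a => /(_ isT).
Qed.

Lemma hull_seps v : v \notin b -> hull_sep v \in seps_lt G k.
Proof. by move=> vb; rewrite inE hull_separation // /sep_order hull_boundary // boundaries. Qed.

Lemma hull_big v : b \subset (hull_sep v).2.
Proof. exact: subsetUr. Qed.

Lemma hull_proper v : v \notin b -> proper_sep (hull_sep v).
Proof.
move=> vb; apply/andP; split; last first.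
  by apply: contra (not_both_sides (hull_seps vb) (hull_big v)); apply: subset_trans (hull_big v).
by apply/subsetPn; exists v; rewrite /= /hull !(in_setU, in_setC) component_refl //= (negPf vb).
Qed.

Lemma big_side_order n m : n \in N -> m \in N -> b \subset n.2 -> b \subset m.2 ->
  [\/ le_sep n m, le_sep m n | le_sep n (flip m)].
Proof.
move=> nN mN bn bm; case/nestedP: (nestedN nN mN) => h.
- by constructor 1.
- by constructor 3.
- case/negP: (not_both_sides (effN_seps mN) bm).
  by case/andP: h => h _; apply: subset_trans h.
- by rewrite le_flip in h; constructor 2.
Qed.

Lemma uncut_far v n : uncut v -> n \in N -> b \subset n.2 -> ~~ meets_separator v n ->
  component b v \subset n.2 :\: n.1.
Proof.
case/andP=> vb /forall_inP h nN bn; rewrite /meets_separator nN bn negbK => dis.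
have := component_side (seps_separation (effN_seps nN)) vb bn dis.
by rewrite (negPf (implyP (h _ nN) bn)).
Qed.

(** If [n] lies below an absorbed separation, it lies below the hull. Otherwise C is strictly on the
    side [n.2], so no absorbed [m] can lie below [n]; then [n] points away from all of them and from
    the whole hull. *)
Lemma hull_nested v n : uncut v -> n \in N -> b \subset n.2 ->
  le_sep n (hull_sep v) \/ le_sep (hull_sep v) (flip n).
Proof.
move=> uv nN bn; have /andP[vb _] := uv.
have sn := seps_separation (effN_seps nN).
case: (boolP (meets_separator v n)) => hn; first by left; apply: hull_le.
have Cn := uncut_far uv nN bn hn.
case: (boolP [exists m, meets_separator v m && le_sep n m]) => [/existsP[m /andP[hm le]]|/existsPn no].
  by left; apply: le_sep_trans le (hull_le hm).
have away m : meets_separator v m -> le_sep n (flip m).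
  move=> hm; have /and3P[mN bm /pred0Pn[w /andP[/= wC]]] := hm.
  rewrite inE => /andP[w1 w2].
  case: (big_side_order nN mN bn bm) => // h; first by have := no m; rewrite hm h.
  case/andP: h => /subsetP/(_ w w1) wn _.
  by have := subsetP Cn w wC; rewrite in_setD wn.
right; apply/andP; split.
  rewrite /= /hull !subUset; apply/andP; split; first (apply/andP; split).
  - by apply: subset_trans Cn (subsetDl _ _).
  - by apply: subset_trans bn; apply/subsetP=> u; rewrite inE => /andP[].
  by apply/bigcupsP=> m /away /andP[_]; apply.
apply/subsetP=> u /= un; rewrite in_setU in_setC.
case ub: (u \in b); first by rewrite orbT.
rewrite orbF /hull !in_setU; apply/negP=> /orP[/orP[uC|]|/bigcupP[m hm um]].
- by have := subsetP Cn u uC; rewrite in_setD un.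
- by rewrite inE ub.
have /andP[/subsetP h1 _] := away m hm.
have := subsetP (separator_sub vb hm) u; rewrite in_setI um (h1 _ un) => /(_ isT).
rewrite in_setU => /orP[uC|]; last by rewrite inE ub.
by have := subsetP Cn u uC; rewrite in_setD un.
Qed.

Lemma hull_eq v w : w \in component b v -> hull_sep w = hull_sep v.
Proof.
move=> h; suff e : hull w = hull v by rewrite /hull_sep e.
rewrite /hull /boundary /meets_separator.
by rewrite (component_eq h).
Qed.

Lemma hull_star v w : uncut v -> uncut w -> w \notin component b v ->
  le_sep (hull_sep v) (flip (hull_sep w)).
Proof.
move=> uv uw wC; have /andP[vb _] := uv; have /andP[wb _] := uw.
have dis u : u \in component b v -> u \notin component b w.
  move=> uv'; apply: contra wC => uw'.
  by rewrite -(component_eq uv') (component_eq uw') component_refl.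
(* The separator of an absorbed [m] lies in [b] and the component of [y]. Another component misses
   it, and being uncut lies strictly on the side of [b]. *)
have cross x y m : uncut x -> (forall u, u \in component b x -> u \notin component b y) ->
    meets_separator y m -> y \notin b -> component b x \subset m.2 :\: m.1.
  move=> ux dxy hm yb; have /and3P[mN bm _] := hm; apply: uncut_far => //.
  rewrite /meets_separator mN bm negbK; apply/pred0P=> u /=; apply/negP=> /andP[uC um].
  have := subsetP (separator_sub yb hm) u um; rewrite in_setU (negPf (dxy _ uC)) /= inE.
  by have /andP[xb _] := ux; rewrite (negPf (component_notin xb uC)).
have dis' u : u \in component b w -> u \notin component b v.
  by move=> h; apply/negP=> /dis; rewrite h.
(* The second side of a hull separation is everything outside the hull together with [b], so overlap
   inside [b] is harmless. *)
suff sub : hull v :&: hull w \subset b.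
  apply/andP; split=> /=.
    apply/subsetP=> u uv'; rewrite in_setU in_setC; case: (boolP (u \in hull w)) => //= h.
    by apply: (subsetP sub); rewrite inE uv'.
  apply/subsetP=> u uw'; rewrite in_setU in_setC; case: (boolP (u \in hull v)) => //= h.
  by apply: (subsetP sub); rewrite inE h.
apply/subsetP=> u; rewrite in_setI => /andP[hv hw]; apply: contraT => ub; exfalso.
have B x : u \notin boundary b x by rewrite inE (negPf ub).
move: hv hw; rewrite /hull !in_setU (negPf (B v)) (negPf (B w)) !orbF.
case/orP=> [uC|/bigcupP[n hn un]] /orP[uD|/bigcupP[m hm um]].
- by have := dis u uC; rewrite uD.
- by have := subsetP (cross _ _ _ uv dis hm wb) u uC; rewrite in_setD um.
- by have := subsetP (cross _ _ _ uw dis' hn vb) u uD; rewrite in_setD un.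
have /and3P[nN bn /pred0Pn[x /andP[/= xC xn]]] := hn.
have /and3P[mN bm /pred0Pn[y /andP[/= yC ym]]] := hm.
have xm := subsetP (cross _ _ _ uv dis hm wb) x xC.
have yn := subsetP (cross _ _ _ uw dis' hn vb) y yC.
move: xn ym xm yn; rewrite !in_setI !in_setD => /andP[xn1 _] /andP[ym1 _] /andP[xm1 _] /andP[yn1 _].
case: (big_side_order nN mN bn bm) => /andP[/subsetP h1 /subsetP h2].
- by rewrite (h1 _ xn1) in xm1.
- by rewrite (h1 _ ym1) in yn1.
have un2 := h2 _ um; have := subsetP (separator_sub vb hn) u; rewrite in_setI un un2 => /(_ isT).
rewrite in_setU (negPf (B v)) orbF => uC.
by have := subsetP (cross _ _ _ uv dis hm wb) u uC; rewrite in_setD um.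
Qed.

Lemma hull_cover v : v \notin b ->
  (exists n, [/\ n \in N, b \subset n.2 & v \notin n.2]) \/ (uncut v /\ v \notin (hull_sep v).2).
Proof.
move=> vb; case: (boolP (uncut v)) => uv.
  right; split=> //; by rewrite /= in_setU in_setC (negPf vb) orbF negbK /hull !in_setU component_refl.
left; move: uv; rewrite /uncut vb /= negb_forall_in => /exists_inP[n nN].
rewrite negb_imply negbK => /andP[bn /subsetP/(_ v (component_refl b v))].
by rewrite in_setD => /andP[vn _]; exists n.
Qed.

End Refinement.
End Unseparated.
End Blocks.

(** * Canonicity *)

Section Separable.
Variables (G : sgraph) (k : nat) (b : {set G}) (T : sgraph) (part : T -> {set G}) (t : T).
Hypothesis td : tree_decomposition part.
Hypothesis adh : adhesion_lt part k.
Hypothesis part_t : part t = b.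

Definition without : rel T := [rel x y | [&& adj x y, x != t & y != t]].

Lemma path_without x p : path (@adj T) x p -> x != t -> t \notin p -> path without x p.
Proof.
elim: p x => //= y p IH x /andP[a hp] xt; rewrite inE negb_or => /andP[ty tp].
by rewrite /without /= a xt eq_sym ty IH // eq_sym.
Qed.

Lemma without_path x p : path without x p -> path (@adj T) x p /\ t \notin p.
Proof.
elim: p x => //= y p IH x /andP[/and3P[a _ yt] /IH[-> h]].
by rewrite a inE negb_or eq_sym yt.
Qed.

(** A tree path through [t] between two parts containing [w] would put [w] into [part t], which is
    [b]. *)
Lemma parts_connected w x y : w \notin b -> w \in part x -> w \in part y -> connect without x y.
Proof.
move=> wb wx wy; have [_ conn _] := td_tree td.
case/connectP: (conn x y) => p0 hp0 e0; case/shortenP: hp0 e0 => p hp up _ e.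
have tn : t \notin x :: p.
  apply/negP => tp; have := subsetP (td_path td hp up tp) w.
  by rewrite inE wx -e wy part_t (negPf wb) => /(_ isT).
move: tn; rewrite inE negb_or => /andP[tx tp].
by apply/connectP; exists p => //; apply: path_without; rewrite // eq_sym.
Qed.

(** All parts meeting the component lie in one branch of T - t. A neighbour in [b] lies in [part t]
    and in a part of that branch, hence in the part at its first node [t']; so the whole boundary
    fits into one adhesion set. *)
Lemma separable_boundary v : v \notin b -> #|boundary b v| < k.
Proof.
move=> vb; have [_ conn _] := td_tree td.
have [tv vtv] : exists tv, v \in part tv.
  have : v \in \bigcup_t part t by rewrite (td_cover td) inE.
  by case/bigcupP => tv _ h; exists tv.
have tvt : tv != t by apply: contraNneq vb => e; rewrite -part_t -e.
have spread w x : w \in component b v -> w \in part x -> connect without tv x.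
  have : component b v \subset [set w | [forall x, (w \in part x) ==> connect without tv x]].
    apply: component_ind => //.
      by rewrite inE; apply/forallP=> y; apply/implyP; apply: parts_connected vtv.
    move=> u y _; rewrite !inE => /forallP hu yb uy; apply/forallP=> z; apply/implyP => yz.
    have [z' [uz' yz']] := td_edge td uy.
    exact: connect_trans (implyP (hu z') uz') (parts_connected yb yz' yz).
  by move=> /subsetP h /h; rewrite inE => /forallP/(_ x)/implyP.
case/connectP: (conn t tv) => p0 hp0 e0; case/shortenP: hp0 e0 => [[|t' p]] /=.
  by move=> _ _ _ e; rewrite e eqxx in tvt.
move=> /andP[tt' hp] /andP[tp _] _ etv; rewrite inE negb_or in tp; case/andP: tp => t't tp.
have ct' : connect without t' tv.
  by apply/connectP; exists p => //; apply: path_without; rewrite // eq_sym.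
apply: leq_ltn_trans (adh tt'); apply: subset_leq_card; apply/subsetP=> z.
rewrite inE => /andP[zb /exists_inP[w wC wz]].
have [x [wx zx]] := td_edge td wz.
rewrite inE part_t zb /=.
case/connectP: (connect_trans ct' (spread _ _ wC wx)) => q0 hq0 e0.
case/shortenP: hq0 e0 => q /without_path[hq tq] uq _ ex.
have ta : path (@adj T) t (t' :: q) by rewrite /= tt' hq.
have tu : uniq (t :: t' :: q) by rewrite cons_uniq uq inE negb_or t't tq.
have m : t' \in t :: t' :: q by rewrite !inE eqxx orbT.
by apply: (subsetP (td_path td ta tu m)); rewrite /= -ex inE part_t zb zx.
Qed.
End Separable.

(** * The action of graph automorphisms on separations and profiles *)

Section Automorphisms.
Variables (G : sgraph) (k : nat) (f : {perm G}).
Hypothesis autf : automorphism f.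
Implicit Types s r n : vpair G.
Implicit Types A P Q N : {set vpair G}.
Implicit Types b : {set G}.
Implicit Types u v w : G.

Definition act s : vpair G := (f @: s.1, f @: s.2).

Lemma act_inj : injective act.
Proof.
move=> [A B] [C D] [/(imset_inj (@perm_inj _ f)) -> /(imset_inj (@perm_inj _ f)) ->] //.
Qed.

Lemma act_surj s : exists r, s = act r.
Proof.
have e (A : {set G}) : f @: (f @^-1: A) = A.
  apply/setP=> u; rewrite -{1}[u](permKV f) (mem_imset _ _ (@perm_inj _ f)) inE permKV //.
by exists (f @^-1: s.1, f @^-1: s.2); rewrite /act /= !e; case: s.
Qed.

Lemma image_sub (A B : {set G}) : (f @: A \subset f @: B) = (A \subset B).
Proof.
apply/idP/idP; last exact: imsetS.
by move/subsetP=> h; apply/subsetP=> u uA; have := h (f u); rewrite !(mem_imset _ _ (@perm_inj _ f)); apply.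
Qed.

Lemma imageI (A B : {set G}) : f @: (A :&: B) = f @: A :&: f @: B.
Proof. by apply: imsetI => x y _ _; apply: perm_inj. Qed.

Lemma imageT : f @: [set: G] = [set: G].
Proof. by apply/setP=> u; rewrite -[u](permKV f) (mem_imset _ _ (@perm_inj _ f)) !inE. Qed.

Lemma imageC (A : {set G}) : f @: (~: A) = ~: (f @: A).
Proof.
by apply/setP=> u; rewrite -[u](permKV f) inE !(mem_imset _ _ (@perm_inj _ f)) inE.
Qed.

Lemma act_le s r : le_sep (act s) (act r) = le_sep s r.
Proof. by rewrite /le_sep !image_sub. Qed.

Lemma act_nested s r : nested (act s) (act r) = nested s r.
Proof. by rewrite /nested -[flip (act s)]/(act (flip s)) -[flip (act r)]/(act (flip r)) !act_le. Qed.

Lemma act_order s : sep_order (act s) = sep_order s.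
Proof. by rewrite /sep_order -imageI card_imset //; apply: perm_inj. Qed.

Lemma act_separation s : separation (act s) = separation s.
Proof.
rewrite /separation /= -imsetU -{1}imageT (inj_eq (imset_inj (@perm_inj _ f))); congr (_ && _).
rewrite !setDE -!imageC -!imageI.
apply/'forall_in_forall_inP/'forall_in_forall_inP => h x hx y hy.
  by rewrite -autf; apply: h; rewrite (mem_imset _ _ (@perm_inj _ f)).
by case/imsetP: hx => x' hx ->; case/imsetP: hy => y' hy ->; rewrite autf; apply: h.
Qed.

Lemma act_seps s : (act s \in seps_lt G k) = (s \in seps_lt G k).
Proof. by rewrite !inE act_separation act_order. Qed.

Lemma act_mem P s : (act s \in act @: P) = (s \in P).
Proof. exact: mem_imset act_inj. Qed.

Lemma act_profile P : profile k P -> profile k (act @: P).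
Proof.
case=> h1 h2 h3 h4; split.
- by apply/subsetP=> _ /imsetP[s sP ->]; rewrite act_seps (subsetP h1).
- by move=> s; have [r ->] := act_surj s; rewrite act_seps -[flip _]/(act (flip r)) !act_mem; apply: h2.
- move=> s r; have [s' ->] := act_surj s; have [r' ->] := act_surj r.
  by rewrite !act_mem act_seps act_le; apply: h3.
move=> s r; have [s' ->] := act_surj s; have [r' ->] := act_surj r.
rewrite !act_mem /= -imageI -imsetU -[(_, _)]/(act (s'.2 :&: r'.2, s'.1 :|: r'.1)) act_mem; apply: h4.
Qed.

Lemma act_distinguishes s P Q : distinguishes (act s) (act @: P) (act @: Q) = distinguishes s P Q.
Proof. by rewrite /distinguishes -[flip _]/(act (flip s)) !act_mem. Qed.

Lemma act_efficient s P Q : efficient (act s) (act @: P) (act @: Q) = efficient s P Q.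
Proof.
rewrite /efficient act_distinguishes; congr (_ && _); apply/forallP/forallP => h r.
  by have := h (act r); rewrite act_separation act_distinguishes !act_order.
by have [r' ->] := act_surj r; rewrite act_separation act_distinguishes !act_order.
Qed.

Definition stable A := forall s, (act s \in A) = (s \in A).

(** An injection of a finite set into itself is onto, so forward invariance suffices. *)
Lemma stableI A : (forall s, s \in A -> act s \in A) -> stable A.
Proof.
move=> h s; have /eqP e : act @: A == A.
  by rewrite eqEcard card_imset ?leqnn ?andbT; [apply/subsetP=> _ /imsetP[r /h ? ->]|apply: act_inj].
by rewrite -{1}e act_mem.
Qed.

Lemma stable_candidates l N : stable N -> stable (candidates k l N).
Proof.
move=> sN; apply: stableI => s /candidatesP[h1 h2 [P [Q [hP hQ e]]]].
apply/candidatesP; rewrite act_order; split=> // [n|].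
  by have [r ->] := act_surj n; rewrite sN act_nested; apply: h2.
exists (act @: P), (act @: Q); split; try exact: act_profile.
by rewrite act_efficient.
Qed.

Lemma act_crossings A s : stable A -> crossings A (act s) = crossings A s.
Proof.
move=> sA; rewrite /crossings -[RHS](card_imset _ act_inj); apply: eq_card => r.
by have [r' ->] := act_surj r; rewrite act_mem !inE sA act_nested.
Qed.

Lemma stable_least_crossing l N : stable N -> stable (least_crossing k l N).
Proof.
move=> sN; have sC := stable_candidates l sN.
apply: stableI => s /least_crossingP[sc [P [Q [hP hQ e m]]]].
apply/least_crossingP; rewrite sC; split=> //.
exists (act @: P), (act @: Q); split; try exact: act_profile; rewrite ?act_efficient //.
move=> r; have [r' ->] := act_surj r; rewrite sC act_efficient !act_crossings //; exact: m.
Qed.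

Lemma stable_level l : stable (level G k l).
Proof.
elim: l => [|l IH] s; first by rewrite !inE.
by rewrite /= !in_setU IH (stable_least_crossing l IH).
Qed.

Lemma image_mem (A : {set G}) u : (f u \in f @: A) = (u \in A).
Proof. exact: mem_imset (@perm_inj _ f). Qed.

Lemma vertex_surj u : exists w, u = f w.
Proof. by exists (f^-1%g u); rewrite permKV. Qed.

Lemma image_component b v : component (f @: b) (f v) = f @: component b v.
Proof.
have av x y : avoiding (f @: b) (f x) (f y) = avoiding b x y.
  by rewrite /avoiding /= autf !image_mem.
apply/setP=> u; have [w ->] := vertex_surj u; rewrite image_mem !inE.
apply/idP/idP => /connectP[p].
  elim: p v => [|y p IH] v /=; first by move=> _ /perm_inj ->.
  have [y' ->] := vertex_surj y; rewrite av => /andP[/connect1 h hp] e.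
  by apply: connect_trans h (IH _ hp e).
elim: p v => [|y p IH] v /=; first by move=> _ ->.
rewrite -av => /andP[/connect1 h hp] e.
by apply: connect_trans h (IH _ hp e).
Qed.

Lemma image_boundary b v : boundary (f @: b) (f v) = f @: boundary b v.
Proof.
apply/setP=> u; have [w ->] := vertex_surj u; rewrite image_mem.
rewrite [f w \in _]inE [w \in boundary b v]inE image_mem image_component; congr (_ && _).
apply/exists_inP/exists_inP=> [[_ /imsetP[x xC ->]]|[x xC a]]; first by rewrite autf; exists x.
by exists (f x); rewrite ?image_mem ?autf.
Qed.

Lemma image_disjoint (A B : {set G}) : [disjoint f @: A & f @: B] = [disjoint A & B].
Proof. exact/imset_disjoint/perm_inj. Qed.

Lemma image_hull N b v : stable N -> hull (f @: b) N (f v) = f @: hull b N v.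
Proof.
move=> sN; rewrite /hull !imsetU image_component image_boundary; congr (_ :|: _).
have ms n : meets_separator (f @: b) N (f v) (act n) = meets_separator b N v n.
  by rewrite /meets_separator sN image_sub image_component -imageI image_disjoint.
apply/setP=> u; have [w ->] := vertex_surj u; rewrite image_mem.
apply/bigcupP/bigcupP=> [[n]|[n hn un]].
  by have [n' ->] := act_surj n; rewrite ms image_mem; exists n'.
by exists (act n); rewrite ?ms ?image_mem.
Qed.

Lemma act_hull_sep N b v : stable N -> hull_sep (f @: b) N (f v) = act (hull_sep b N v).
Proof. by move=> sN; rewrite /hull_sep /act image_hull //= imsetU imageC. Qed.

Lemma act_uncut N b v : stable N -> uncut (f @: b) N (f v) = uncut b N v.
Proof.
move=> sN; rewrite /uncut image_mem image_component; congr (_ && _).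
apply/forall_inP/forall_inP=> h n.
  move=> nN; have := h (act n); rewrite sN image_sub.
  by rewrite /= setDE -imageC -imageI image_sub -setDE => /(_ nN).
have [n' ->] := act_surj n; rewrite sN image_sub => /h.
by rewrite /= [f @: _ :\: _]setDE -imageC -imageI image_sub -setDE.
Qed.

Lemma image_unseparated b : unseparated k (f @: b) = unseparated k b.
Proof.
have e s : separates (act s) (f @: b) = separates s b.
  by rewrite /separates /= !setDE -!imageC -!imageI !imset_eq0.
apply/forall_inP/forall_inP=> h s.
  by move=> sk; rewrite -e; apply: h; rewrite act_seps.
by have [s' ->] := act_surj s; rewrite act_seps e; apply: h.
Qed.

Lemma image_block b : block k b -> block k (f @: b).
Proof.
case/andP=> /maxsetP[h1 h2] h3; apply/andP; split; last by rewrite card_imset //; apply: perm_inj.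
apply/maxsetP; split; first by rewrite image_unseparated.
move=> B hB sub; have e : B = f @: (f @^-1: B).
  by apply/setP=> u; have [w ->] := vertex_surj u; rewrite image_mem inE.
rewrite e in hB sub *; rewrite image_sub in sub; rewrite image_unseparated in hB.
by rewrite (h2 _ hB sub).
Qed.

End Automorphisms.

(** * The refined tree set *)

Section Refined.
Variables (G : sgraph) (k : nat).
Implicit Types s r n m : vpair G.
Implicit Types N : {set vpair G}.
Implicit Types b : {set G}.

(** The decidable trace that separability leaves on a block, free of any tree-decomposition. *)
Definition loose_block b : bool :=
  block k b && [forall v, (v \notin b) ==> (#|boundary b v| < k)].

Definition hull_seps_of N : {set vpair G} :=
  [set s | [exists b, exists v, [&& loose_block b, uncut b N v & s == hull_sep b N v]]].

Definition refinement N : {set vpair G} :=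
  N :|: hull_seps_of N :|: [set s | flip s \in hull_seps_of N].

Lemma hull_seps_ofP N s :
  reflect (exists b v, [/\ loose_block b, uncut b N v & s = hull_sep b N v]) (s \in hull_seps_of N).
Proof.
rewrite inE; apply: (iffP existsP) => [[b /existsP[v /and3P[h1 h2 /eqP h3]]]|[b [v [h1 h2 ->]]]].
  by exists b, v.
by exists b; apply/existsP; exists v; rewrite h1 h2 eqxx.
Qed.

Lemma stable_refinement (f : {perm G}) N : automorphism f -> stable f N -> stable f (refinement N).
Proof.
move=> autf sN.
have sH : stable f (hull_seps_of N).
  apply: stableI => s /hull_seps_ofP[b [v [/andP[h1 /forallP h2] h3 ->]]].
  apply/hull_seps_ofP; exists (f @: b), (f v); rewrite act_uncut // act_hull_sep //; split=> //.
  apply/andP; split; first exact: image_block.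
  apply/forallP=> u; have [w ->] := vertex_surj f u.
  by rewrite image_mem image_boundary // card_imset //; apply: perm_inj.
move=> s; rewrite /refinement !in_setU sN sH; congr (_ || _).
by rewrite [LHS]in_set [RHS]in_set -[flip (act f s)]/(act f (flip s)) sH.
Qed.

(** If the profiles agree, every separation of order below [k] has [b] and [b'] together on one
    side, so their union is unseparated and equals both by maximality. *)
Lemma block_eq b b' : block k b -> block k b' ->
  block_profile k b = block_profile k b' -> b = b'.
Proof.
move=> /andP[/maxsetP[u1 m1] k1] /andP[/maxsetP[u2 m2] k2] e.
have un : unseparated k (b :|: b').
  apply/forall_inP=> s sk; rewrite /separates negb_and !negbK.
  have side q : q \in seps_lt G k -> b \subset q.2 -> b' \subset q.2.
    move=> qk h; have : q \in block_profile k b by rewrite inE qk.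
    by rewrite e inE => /andP[].
  case/orP: (big_side u1 sk) => h; apply/orP.
    right; have h' := side (flip s); rewrite seps_flip in h'; have {}h' := h' sk h.
    apply/eqP/setP=> u; rewrite !inE; apply/negP=> /and3P[/orP[ub|ub] /negP ns _]; apply: ns.
      exact: subsetP h _ ub.
    exact: subsetP h' _ ub.
  left; have h' := side s sk h.
  apply/eqP/setP=> u; rewrite !inE; apply/negP=> /and3P[/orP[ub|ub] /negP ns _]; apply: ns.
    exact: subsetP h _ ub.
  exact: subsetP h' _ ub.
by rewrite -(m1 _ un (subsetUl _ _)) (m2 _ un (subsetUr _ _)).
Qed.

Section Level.
Variable N : {set vpair G}.
Hypothesis effN : forall n, n \in N -> exists P Q, [/\ profile k P, profile k Q & efficient n P Q].
Hypothesis nestedN : forall n m, n \in N -> m \in N -> nested n m.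
Hypothesis flipN : forall n, n \in N -> flip n \in N.
Hypothesis distN : forall P Q, profile k P -> profile k Q -> P <> Q ->
  exists2 n, n \in N & efficient n P Q.

Lemma loose_blockP b : loose_block b ->
  [/\ block k b, unseparated k b, k <= #|b| & forall v, v \notin b -> #|boundary b v| < k].
Proof.
case/andP=> h1 /forallP h2; have /andP[/maxsetP[h3 _] h4] := h1.
by split=> // v; apply/implyP.
Qed.

Lemma refinement_seps s : s \in refinement N -> s \in seps_lt G k.
Proof.
have H r : r \in hull_seps_of N -> r \in seps_lt G k.
  case/hull_seps_ofP=> b [v [/loose_blockP[_ h2 h3 h4] /andP[vb _] ->]].
  exact: (hull_seps effN h4 vb).
rewrite !in_setU in_set => /orP[/orP[/(effN_seps effN)//|/H//]|/H]; by rewrite seps_flip.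
Qed.

Lemma refinement_flip s : s \in refinement N -> flip s \in refinement N.
Proof.
case/setUP=> [/setUP[/flipN h|h]|h]; apply/setUP.
- by left; apply/setUP; left.
- by right; rewrite in_set flipK.
by left; apply/setUP; right; rewrite in_set in h.
Qed.

Lemma refinement_proper s : s \in refinement N -> proper_sep s.
Proof.
have fl r : proper_sep (flip r) = proper_sep r by rewrite /proper_sep andbC.
have H r : r \in hull_seps_of N -> proper_sep r.
  case/hull_seps_ofP=> b [v [/loose_blockP[_ h2 h3 h4] /andP[vb _] ->]].
  exact: (hull_proper h3 effN h4 vb).
rewrite !in_setU in_set => /orP[/orP[/effN|/H//]|/H]; last by rewrite fl.
case=> P [Q [hP hQ e]]; have [A [B [hA hB sA sB _]]] := orient_efficient hP hQ e.
have fB : flip s \in B by rewrite (profile_flip hB (profile_seps hA sA)).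
by rewrite /proper_sep (profile_proper hA sA) (profile_proper hB fB).
Qed.

Lemma side_cases b n : unseparated k b -> n \in N -> exists2 m, m \in N & b \subset m.2 /\ (m = n \/ m = flip n).
Proof.
move=> ub nN; case/orP: (big_side ub (effN_seps effN nN)) => h; last by exists n; auto.
by exists (flip n); auto.
Qed.

Lemma hull_seps_nested s r : s \in hull_seps_of N -> r \in hull_seps_of N -> nested s r.
Proof.
case/hull_seps_ofP=> b [v [hb hv ->]]; case/hull_seps_ofP=> b' [v' [hb' hv' ->]].
have [bb ub kb db] := loose_blockP hb; have [bb' ub' kb' db'] := loose_blockP hb'.
case: (eqVneq b b') hv' => [<-|nb] hv'.
  case: (boolP (v' \in component b v)) => h.
    by rewrite (hull_eq _ h) nested_refl.
  rewrite -nested_flipr; apply: le_nested; exact: (hull_star kb effN nestedN db hv hv').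
(* An element of [N] distinguishing the two induced profiles has the blocks on opposite sides. Both
   hull separations are comparable with one of its orientations, and these comparisons chain. *)
have [|n nN en] := distN (block_profileP ub kb) (block_profileP ub' kb').
  by move/(block_eq bb bb')/eqP; rewrite (negPf nb).
have [A [B [hA hB nA nB _]]] := orient_efficient (block_profileP ub kb) (block_profileP ub' kb') en.
have [m mN [bm b'm]] : exists2 m, m \in N & b \subset m.2 /\ b' \subset m.1.
  have nk := effN_seps effN nN.
  case/andP: en => /orP[] /andP[]; rewrite !in_set => /andP[_ h1] /andP[_ h2] _.
    by exists n.
  by exists (flip n); auto.
have c1 := hull_nested kb effN nestedN db hv mN bm.
have c2 := hull_nested kb' effN nestedN db' hv' (flipN mN) b'm.
rewrite flipK in c2; apply/nestedP.
case: c1 => h1; case: c2 => h2.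
- by constructor 3; apply: le_sep_trans h2; rewrite le_flip.
- by constructor 4; rewrite le_flip; apply: le_sep_trans h1.
- by constructor 1; apply: le_sep_trans h2.
- by constructor 2; apply: le_sep_trans h1 _; rewrite le_flip.
Qed.

Lemma hull_level_nested s n : s \in hull_seps_of N -> n \in N -> nested s n.
Proof.
case/hull_seps_ofP=> b [v [hb hv ->]] nN; have [bb ub kb db] := loose_blockP hb.
have [m mN [bm em]] := side_cases ub nN.
have -> : nested (hull_sep b N v) n = nested (hull_sep b N v) m by case: em => ->; rewrite ?nested_flipr.
case: (hull_nested kb effN nestedN db hv mN bm) => h.
  by rewrite nested_sym le_nested.
by rewrite -nested_flipr le_nested.
Qed.

Lemma refinement_tree_set : tree_set (refinement N).
Proof.
split.
- by move=> s /refinement_seps/seps_separation.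
- exact: refinement_flip.
- have base s r : s \in N :|: hull_seps_of N -> r \in N :|: hull_seps_of N -> nested s r.
    rewrite !in_setU => /orP[hs|hs] /orP[hr|hr].
    + exact: nestedN.
    + by rewrite nested_sym hull_level_nested.
    + exact: hull_level_nested.
    + exact: hull_seps_nested.
  have red s : s \in refinement N -> s \in N :|: hull_seps_of N \/ flip s \in N :|: hull_seps_of N.
    case/setUP=> [->|]; first by left.
    by rewrite in_set => h; right; rewrite in_setU h orbT.
  move=> s r /red[hs|hs] /red[hr|hr].
  + exact: base.
  + by rewrite -nested_flipr base.
  + by rewrite -nested_flipl base.
  + by rewrite -nested_flipl -nested_flipr base.
- exact: refinement_proper.
Qed.

End Level.
End Refined.

(** * The induced automorphism of the tree *)

Section NodeAutomorphism.
Variables (G : sgraph) (f : {perm G}) (N : {set vpair G}).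
Hypothesis autf : automorphism f.
Hypothesis sN : stable f N.
Hypothesis tsN : tree_set N.

Lemma act_orientation (O : {set vpair G}) : orientation N O -> orientation N (act f @: O).
Proof.
case/orientationP => h1 h2 h3; apply/orientationP; split.
- by move=> _ /imsetP[s /h1 sO ->]; rewrite sN.
- by move=> s; have [r ->] := act_surj f s; rewrite sN -[flip _]/(act f (flip r)) !act_mem; apply: h2.
move=> s r; have [s' ->] := act_surj f s; have [r' ->] := act_surj f r.
by rewrite sN !act_mem act_le; apply: h3.
Qed.

Definition act_node (O : node N) : node N := Sub (act f @: val O) (act_orientation (valP O)).

Lemma act_node_inj : injective act_node.
Proof. by move=> O O' /(congr1 val) /= /(imset_inj (@act_inj G f)) /val_inj. Qed.

Lemma act_edge_end s : edge_end N (act f s) = act f @: edge_end N s.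
Proof.
apply/setP=> r; have [r' ->] := act_surj f r; rewrite act_mem !inE sN act_le.
by rewrite -[flip (act f s)]/(act f (flip s)) act_le (inj_eq (@act_inj G f)).
Qed.

Lemma node_part_act (O : node N) : f @: node_part O = node_part (act_node O).
Proof.
apply/setP=> u; have [w ->] := vertex_surj f u; rewrite image_mem.
apply/bigcapP/bigcapP=> /= h s.
  by case/imsetP=> r rO ->; rewrite /= image_mem; apply: h.
by move=> sO; have := h (act f s); rewrite act_mem image_mem; apply.
Qed.

Lemma act_node_automorphism :
  automorphism (perm act_node_inj : {perm node_graph tsN}).
Proof.
move=> O O'; rewrite !permE; apply/exists_inP/exists_inP => [[s]|[s sN' /andP[/eqP h1 /eqP h2]]].
  have [s' ->] := act_surj f s; rewrite sN -[flip _]/(act f (flip s')) !act_edge_end /=.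
  by rewrite !(inj_eq (imset_inj (@act_inj G f))); exists s'.
exists (act f s); rewrite ?sN // -[flip _]/(act f (flip s)) !act_edge_end /=.
by rewrite -h1 -h2 !eqxx.
Qed.

End NodeAutomorphism.

Theorem theorem1 (k : nat) (G : sgraph) :
  exists (T : sgraph) (part : T -> {set G}),
    [/\ tree_decomposition part,
        canonical part,
        adhesion_lt part k,
        (forall P Q : {set vpair G}, profile k P -> profile k Q -> P <> Q ->
           td_distinguishes_efficiently part P Q) &
        (forall b : {set G}, block k b -> separable k b ->
           exists t : T, part t = b /\
             forall t' : T, b \subset part t' -> t' = t)].
Proof.
(* An efficient separation of two k-profiles has order below [k], so [k] levels treat all pairs. *)
pose N := level G k k; have [effN0 nestedN flipN dist0] := level_spec G k k.
have effN n : n \in N -> exists P Q, [/\ profile k P, profile k Q & efficient n P Q].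
  by case/effN0.
have distN P Q : profile k P -> profile k Q -> P <> Q -> exists2 n, n \in N & efficient n P Q.
  move=> hP hQ nPQ; have [s e] := efficient_exists hP hQ nPQ.
  have ds : distinguishes s P Q by case/andP: e.
  apply: (dist0 _ _ _ hP hQ e).
  by have := distinguishes_seps hP hQ ds; rewrite inE => /andP[].
have tsR := refinement_tree_set effN nestedN flipN distN.
have sepsR := refinement_seps effN.
have ordR s : s \in refinement k N -> sep_order s < k by move/sepsR; rewrite inE => /andP[].
exists (node_graph tsR), (@node_part G (refinement k N)); split.
- exact: node_td.
- move=> f autf; have sR := stable_refinement k autf (stable_level k autf k).
  exists (perm (@act_node_inj _ _ _ sR)); split; first exact: act_node_automorphism.
  by move=> O; rewrite (node_part_act sR) permE.
- exact: node_adhesion.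
- move=> P Q hP hQ /(distN _ _ hP hQ)[n nN e].
  have nR : n \in refinement k N by rewrite !in_setU nN.
  have fR : flip n \in refinement k N by apply: ts_flip tsR _ _.
  (* This oriented edge induces [flip n], which is as efficient as [n]. *)
  exists (end_node tsR nR), (end_node tsR fR); split; first exact: adj_end_nodes.
  by rewrite induced_end_node; apply/efficientP; rewrite efficient_flip.
move=> b bb [T [part [td adh [t pt]]]].
have lb : loose_block k b.
  rewrite /loose_block bb; apply/forallP=> v; apply/implyP=> vb.
  exact: (separable_boundary td adh pt vb).
have [_ ub kb _] := loose_blockP lb.
apply: (node_of_set tsR ordR kb) => [s /sepsR sk|v vb]; first exact: (big_side ub sk).
case: (hull_cover N vb) => [[n [nN bn vn]]|[uv vh]].
  by exists n; rewrite !in_setU nN.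
exists (hull_sep b N v); split=> //; last exact: hull_big.
rewrite !in_setU; apply/orP; left; apply/orP; right.
by apply/hull_seps_ofP; exists b, v.
Qed.
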